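(* Let $G$ be a finite abelian group, $\mathbb{F}$ a field, and let $\mathcal{A}=\mathrm{M}_{x_0}\otimes\bigotimes_{i=1}^\infty\mathrm{M}_{a_i}$ be in standard form, with $\operatorname{supp}(a_i)=S$ for all $i\ge 1$ and $\operatorname{supp}(x_0)\subseteq S$. Then $$K_0^{\mathrm{gr}}(\mathcal{A})\cong\bigl(K(\mathcal{A}),K^+(\mathcal{A}),\pi_S(\bar{x}_0)\bigr)$$ as triples (partially ordered $\mathbb{Z}G$-modules with order-unit).
   Context: All algebras are associative and unital over $\mathbb{F}$. A $G$-grading on $\mathcal{A}$ is a decomposition $\mathcal{A}=\bigoplus_{g\in G}\mathcal{A}_g$ into subspaces with $\mathcal{A}_g\mathcal{A}_h\subseteq\mathcal{A}_{gh}$; homomorphisms of graded algebras preserve components, and $\cong$ means isomorphism of graded algebras. **Matrix algebras.** For $0\ne x=\sum_g x_g g\in\mathbb{Z}_{\ge0}G$, let $n=\sum_g x_g$ and choose $(g_1,\dots,g_n)\in G^n$ in which each $g$ occurs $x_g$ times. $\mathrm{M}_x$ is $\mathrm{M}_n(\mathbb{F})$ with the (elementary) grading in which the matrix unit $E_{ij}$ has degree $g_ig_j^{-1}$; it is well defined up to graded isomorphism. Tensor products are graded by $\deg(a\otimes b)=\deg a\deg b$, and $\mathrm{M}_x\otimes\mathrm{M}_y\cong\mathrm{M}_{xy}$. **Infinite products.** For nonzero $x_0,a_1,a_2,\ldots\in\mathbb{Z}_{\ge0}G$, $\mathrm{M}_{x_0}\otimes\bigotimes_{i=1}^\infty\mathrm{M}_{a_i}$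 denotes the direct limit of $\mathrm{M}_{x_0}\to\mathrm{M}_{x_1}\to\mathrm{M}_{x_2}\to\cdots$, where $x_i=x_0a_1\cdots a_i$ and $\mathrm{M}_{x_{i-1}}\to\mathrm{M}_{x_{i-1}}\otimes\mathrm{M}_{a_i}\cong\mathrm{M}_{x_i}$ is $z\mapsto z\otimes1$. **Idempotents and supp.** Let $\Gamma=\mathrm{Gal}(\overline{\mathbb{Q}}/\mathbb{Q})$ act on $\hat G=\mathrm{Hom}(G,\overline{\mathbb{Q}}^\times)$ by post-composition. For an orbit $j\in\hat G/\Gamma$ put $e_j=\sum_{\chi\in j}e_\chi\in\mathbb{Q}G$, where $e_\chi=\frac1{|G|}\sum_{g\in G}\chi(g)^{-1}g$, and $\mathbb{L}_j=e_j\mathbb{Q}G$ (a field); then $\mathbb{Q}G=\prod_j\mathbb{L}_j$. For $S\subseteq\hat G/\Gamma$ let $\mathbb{L}_S=\prod_{j\in S}\mathbb{L}_j$, an ideal of $\mathbb{Q}G$ and a ring with identity $\sum_{j\in S}e_j$, and let $\pi_S:\mathbb{Q}G\to\mathbb{L}_S$, $\pi_S(z)=\sum_{j\in S}e_jz$. For $z\in\mathbb{Q}G$, $\operatorname{supp}(z)=\{j\in\hat G/\Gamma\mid e_jz\neq0\}$. For $z=\sum_g z_gg$, $\bar z=\sum_g z_gg^{-1}$; one has $\operatorname{supp}(\bar z)=\operatorname{supp}(z)$. **Standard form.** $\mathrm{M}_{x_0}\otimes\bigotimes_{i=1}^\infty\mathrm{M}_{a_i}$ is in standard form if $\operatorname{supp}(a_i)$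 is a fixed set $S$ independent of $i\ge1$ and $\operatorname{supp}(x_0)\subseteq S$. **$K$ and $K^+$.** For $\mathcal{A}$ in standard form let $b_i=\prod_{k=1}^i\bar a_k$; each $\pi_S(b_i)$ is invertible in $\mathbb{L}_S$. Define the subsets of $\mathbb{L}_S$ $$K^+(\mathcal{A})=\bigcup_{i=1}^\infty\frac1{\pi_S(b_i)}\pi_S(\mathbb{Z}_{\ge0}G),\qquad K(\mathcal{A})=\bigcup_{i=1}^\infty\frac1{\pi_S(b_i)}\pi_S(\mathbb{Z}G),$$ on which $\mathbb{Z}G$ acts by multiplication. **Graded $K_0$.** For a unital $G$-graded algebra $\mathcal{A}$, $K_0^{\mathrm{gr}}(\mathcal{A})^+$ is the commutative monoid (under $\oplus$) of isomorphism classes $[P]$ of finitely generated projective graded left $\mathcal{A}$-modules; $K_0^{\mathrm{gr}}(\mathcal{A})$ is its group completion, a $\mathbb{Z}G$-module via $g[P]=[P^{[g]}]$, where $P^{[g]}_h=P_{hg^{-1}}$. $K_0^{\mathrm{gr}}(\mathcal{A})$ also stands for the triple $(K_0^{\mathrm{gr}}(\mathcal{A}),K_0^{\mathrm{gr}}(\mathcal{A})^+,[\mathcal{A}])$. A morphism $(K,K^+,u)\to(K',K'^+,u')$ is a $\mathbb{Z}G$-module homomorphism $\varphi$ with $\varphi(K^+)\subseteq K'^+$ and $\varphi(u)=u'$; an isomorphism is an invertible morphism. *)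

(* Defs.v *)
From HB Require Import structures.
From mathcomp Require Import all_boot all_order all_fingroup all_algebra.
From mathcomp Require Import all_solvable all_field all_character.
From mathcomp Require Import generic_quotient boolp mxtens.
Set Implicit Arguments.
Unset Strict Implicit.
Unset Printing Implicit Defensive.
Import GRing.Theory.
Local Open Scope ring_scope.

Section Quotient.
Variables (T : Type) (R : T -> T -> Prop).
Hypotheses (Rxx : forall x, R x x) (Rsym : forall x y, R x y -> R y x).
Hypothesis Rtrans : forall x y z, R x y -> R y z -> R x z.

Definition classes_of := {C : T -> Prop | exists x, C = R x}.
Definition class_of (x : T) : classes_of := exist _ (R x) (ex_intro _ x erefl).
Definition rep_of (C : classes_of) : T := sval (cid (svalP C)).

Lemma classes_of_inj (C D : classes_of) : sval C = sval D -> C = D.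
Proof.
case: C D => C hC [D hD] /= E; case: D / E in hD *.
by congr exist; apply: Prop_irrelevance.
Qed.

Lemma rep_ofK C : class_of (rep_of C) = C.
Proof. by apply: classes_of_inj; rewrite /rep_of; case: cid => x /= <-. Qed.

Lemma class_ofP x y : class_of x = class_of y <-> R x y.
Proof.
split=> [[E]|Rxy]; first by rewrite E.
apply: classes_of_inj => /=; apply/funext => z; apply/propext.
by split; apply: Rtrans => //; apply: Rsym.
Qed.
End Quotient.

(* A commutative monoid with an additive action of G. MathComp's algebraic
   structures cannot be used for K_0: their carriers all live in the universe
   of the carriers of modules, one below that of isomorphism classes. *)
Record cmonoid (G : finZmodType) := CMonoid {
  cm_sort :> Type;
  cm_zero : cm_sort;
  cm_add : cm_sort -> cm_sort -> cm_sort;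
  cm_act : G -> cm_sort -> cm_sort;
  cm_addA : forall x y z, cm_add x (cm_add y z) = cm_add (cm_add x y) z;
  cm_addC : forall x y, cm_add x y = cm_add y x;
  cm_add0 : forall x, cm_add cm_zero x = x;
  cm_act0 : forall x, cm_act 0 x = x;
  cm_actD : forall g h x, cm_act (g + h) x = cm_act g (cm_act h x);
  cm_act_zero : forall g, cm_act g cm_zero = cm_zero;
  cm_act_add : forall g x y,
    cm_act g (cm_add x y) = cm_add (cm_act g x) (cm_act g y) }.

(* A Z G-module, given as an abelian group with an additive action of G. *)
Record zgmod (G : finZmodType) := ZGMod {
  zg_cmonoid :> cmonoid G;
  zg_opp : zg_cmonoid -> zg_cmonoid;
  zg_addN : forall x, cm_add (zg_opp x) x = cm_zero zg_cmonoid }.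

Section GroupCompletion.
Variables (G : finZmodType) (M : cmonoid G).
Local Notation "x :+ y" := (@cm_add G M x y) (at level 50, left associativity).

Definition gc_rel (p q : M * M) : Prop :=
  exists r, p.1 :+ q.2 :+ r = q.1 :+ p.2 :+ r.


HB.instance Definition _ := Monoid.isComLaw.Build M (cm_zero M) (@cm_add G M)
  (@cm_addA G M) (@cm_addC G M) (@cm_add0 G M).

Lemma gc_refl p : gc_rel p p. Proof. by exists p.1. Qed.
Lemma gc_sym p q : gc_rel p q -> gc_rel q p.
Proof. by case=> r E; exists r. Qed.
Lemma gc_trans p q s : gc_rel p q -> gc_rel q s -> gc_rel p s.
Proof.
case=> r E [r' E']; exists ((q.2 :+ r) :+ (q.1 :+ r')).
have := congr2 (@cm_add G M) E E'.
rewrite (AC (3*3) ((1*5)*((2*3)*(4*6)))) /= => ->.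
by rewrite (AC (3*3) ((4*2)*((5*3)*(1*6)))).
Qed.

Definition gc_sort := classes_of gc_rel.
Definition gc_cls (p : M * M) : gc_sort := class_of gc_rel p.

Lemma gc_clsP p q : gc_cls p = gc_cls q <-> gc_rel p q.
Proof. exact: (class_ofP gc_refl gc_sym gc_trans). Qed.

Lemma gc_clsE (x : gc_sort) : exists p, x = gc_cls p.
Proof. by exists (rep_of x); rewrite /gc_cls rep_ofK. Qed.

Definition gc_add (x y : gc_sort) : gc_sort :=
  let p := rep_of x in let q := rep_of y in gc_cls (p.1 :+ q.1, p.2 :+ q.2).
Definition gc_opp (x : gc_sort) : gc_sort :=
  let p := rep_of x in gc_cls (p.2, p.1).
Definition gc_act (g : G) (x : gc_sort) : gc_sort :=
  let p := rep_of x in gc_cls (cm_act g p.1, cm_act g p.2).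
Definition gc_zero : gc_sort := gc_cls (cm_zero M, cm_zero M).
Definition gc_in (x : M) : gc_sort := gc_cls (x, cm_zero M).

Lemma gc_repP p : gc_rel (rep_of (gc_cls p)) p.
Proof. by apply/gc_clsP; apply: rep_ofK. Qed.

Lemma gc_addE p q : gc_add (gc_cls p) (gc_cls q) = gc_cls (p.1 :+ q.1, p.2 :+ q.2).
Proof.
apply/gc_clsP; case: (gc_repP p) (gc_repP q) => r E [r' E'].
exists (r :+ r'); have := congr2 (@cm_add G M) E E'; move=> /= {}E.
rewrite (AC (2*2*2) ((1*3*5)*(2*4*6))) /= E.
by rewrite (AC (3*3) (1*4*(2*5)*(3*6))).
Qed.

Lemma gc_oppE p : gc_opp (gc_cls p) = gc_cls (p.2, p.1).
Proof.
apply/gc_clsP; case: (gc_repP p) => r E; exists r => /=.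
by rewrite (cm_addC _ p.1) (cm_addC p.2) -E.
Qed.

Lemma gc_actE g p : gc_act g (gc_cls p) = gc_cls (cm_act g p.1, cm_act g p.2).
Proof.
apply/gc_clsP; case: (gc_repP p) => r E; exists (cm_act g r) => /=.
by rewrite -!cm_act_add E.
Qed.

Fact gc_addA x y z : gc_add x (gc_add y z) = gc_add (gc_add x y) z.
Proof.
case: (gc_clsE x) (gc_clsE y) (gc_clsE z) => p -> [q ->] [s ->].
by rewrite !gc_addE /= !cm_addA.
Qed.
Fact gc_addC x y : gc_add x y = gc_add y x.
Proof.
case: (gc_clsE x) (gc_clsE y) => p -> [q ->].
by rewrite !gc_addE /= (cm_addC p.1) (cm_addC p.2).
Qed.
Fact gc_add0 x : gc_add gc_zero x = x.
Proof. by case: (gc_clsE x) => -[p q] ->; rewrite gc_addE /= !cm_add0. Qed.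
Fact gc_act0 x : gc_act 0 x = x.
Proof. by case: (gc_clsE x) => -[p q] ->; rewrite gc_actE /= !cm_act0. Qed.
Fact gc_actD g h x : gc_act (g + h) x = gc_act g (gc_act h x).
Proof. by case: (gc_clsE x) => p ->; rewrite !gc_actE /= !cm_actD. Qed.
Fact gc_act_zero g : gc_act g gc_zero = gc_zero.
Proof. by rewrite gc_actE /= cm_act_zero. Qed.
Fact gc_act_add g x y : gc_act g (gc_add x y) = gc_add (gc_act g x) (gc_act g y).
Proof.
case: (gc_clsE x) (gc_clsE y) => p -> [q ->].
by rewrite !(gc_addE, gc_actE) /= !cm_act_add.
Qed.
Fact gc_addN x : gc_add (gc_opp x) x = gc_zero.
Proof.
case: (gc_clsE x) => p ->; rewrite gc_oppE gc_addE; apply/gc_clsP.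
by exists (cm_zero M); rewrite /= (AC (2*1*1) (3*(2*1)*4)).
Qed.

Definition group_completion : zgmod G :=
  ZGMod (zg_cmonoid := CMonoid gc_addA gc_addC gc_add0 gc_act0 gc_actD
    gc_act_zero gc_act_add) gc_addN.
End GroupCompletion.

(* A triple (K, K^+, u); the module K is given as a subset of an ambient
   Z G-module. *)
Record triple (G : finZmodType) := Triple {
  tr_amb :> zgmod G;
  tr_K : tr_amb -> Prop;
  tr_pos : tr_amb -> Prop;
  tr_unit : tr_amb }.

Section TripleMorphisms.
Variable G : finZmodType.

Definition triple_mor (K L : triple G) (f : K -> L) : Prop :=
  [/\ forall x, tr_K x -> tr_K (f x),
      forall x y, tr_K x -> tr_K y -> f (cm_add x y) = cm_add (f x) (f y),
      forall g x, tr_K x -> f (cm_act g x) = cm_act g (f x),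
      forall x, tr_pos x -> tr_pos (f x)
    & f (tr_unit K) = tr_unit L].

Definition triple_iso (K L : triple G) : Prop :=
  exists (f : K -> L) (h : L -> K),
    [/\ triple_mor f, triple_mor h,
        forall x, tr_K x -> h (f x) = x
      & forall y, tr_K y -> f (h y) = y].
End TripleMorphisms.

Section Graded.
Variables (F : fieldType) (G : finZmodType).

(* V is the direct sum of the subgroups c g. *)
Definition is_grading (V : zmodType) (c : G -> V -> Prop) : Prop :=
  [/\ forall g, c g 0,
      forall g x y, c g x -> c g y -> c g (x - y)
    & forall v, exists! d : {ffun G -> V},
        (forall g, c g (d g)) /\ \sum_g d g = v].

Record galg := GAlg {
  galg_sort :> algType F;
  gcomp : G -> galg_sort -> Prop;
  gcomp_grading : is_grading gcomp;
  gcompZ : forall g k x, gcomp g x -> gcomp g (k *: x);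
  gcompM : forall g h x y, gcomp g x -> gcomp h y -> gcomp (g + h) (x * y) }.

(* The components of a graded module are F-subspaces, as F 1 lies in the
   identity component of the algebra. *)
Record gmod (A : galg) := GMod {
  gmod_sort :> lmodType A;
  mcomp : G -> gmod_sort -> Prop;
  mcomp_grading : is_grading mcomp;
  mcompZ : forall g h (a : A) x,
    gcomp g a -> mcomp h x -> mcomp (g + h) (a *: x) }.

Definition graded_hom (A : galg) (P Q : gmod A) (f : P -> Q) : Prop :=
  forall g x, mcomp g x -> mcomp g (f x).

Definition gmod_iso (A : galg) (P Q : gmod A) : Prop :=
  exists (f : {linear P -> Q}) (h : {linear Q -> P}),
    [/\ graded_hom f, graded_hom h, cancel f h & cancel h f].

Definition fin_gen (A : galg) (P : gmod A) : Prop :=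
  exists (n : nat) (e : 'I_n -> P),
    forall x, exists c : 'I_n -> A, x = \sum_i c i *: e i.

(* Projectivity in the category of graded modules and graded maps. *)
Definition gprojective (A : galg) (P : gmod A) : Prop :=
  forall (M N : gmod A) (p : {linear M -> N}) (f : {linear P -> N}),
    graded_hom p -> (forall y, exists x, p x = y) -> graded_hom f ->
    exists2 h : {linear P -> M}, graded_hom h & p \o h =1 f.
End Graded.

Definition mk_linear (R : pzRingType) (U V : lmodType R) (f : U -> V)
    (lf : linear f) : {linear U -> V} :=
  HB.pack f (GRing.isLinear.Build R U V *:%R f lf).

Section GradedModules.
Variables (F : fieldType) (G : finZmodType) (A : galg F G).
Implicit Types P Q R M N : gmod A.

Section Gradings.
Variables (V : zmodType) (c : G -> V -> Prop).
Hypothesis gr : is_grading c.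

Lemma grading0 g : c g 0. Proof. by case: gr. Qed.
Lemma gradingB g x y : c g x -> c g y -> c g (x - y).
Proof. by case: gr => _ + _; apply. Qed.
Lemma gradingN g x : c g x -> c g (- x).
Proof. by rewrite -sub0r; apply: gradingB; apply: grading0. Qed.
Lemma gradingD g x y : c g x -> c g y -> c g (x + y).
Proof. by move=> cx cy; rewrite -[y]opprK; apply/gradingB/gradingN. Qed.
Lemma grading_sum g (I : Type) (r : seq I) (Pr : pred I) (f : I -> V) :
  (forall i, Pr i -> c g (f i)) -> c g (\sum_(i <- r | Pr i) f i).
Proof.
by move=> cf; apply: big_ind cf; [apply: grading0 | apply: gradingD].
Qed.

Lemma grading_ex v : exists d : {ffun G -> V},
  (forall g, c g (d g)) /\ \sum_g d g = v.
Proof. by case: gr => _ _ /(_ v) [d [hd _]]; exists d. Qed.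

Lemma grading_uniq (d d' : {ffun G -> V}) :
  (forall g, c g (d g)) -> (forall g, c g (d' g)) ->
  \sum_g d g = \sum_g d' g -> d = d'.
Proof.
case: gr => _ _ /(_ (\sum_g d g)) [e [_ eu]] cd cd' E.
by rewrite -(eu d) // -(eu d').
Qed.

Lemma grading_eq0 (d : {ffun G -> V}) :
  (forall g, c g (d g)) -> \sum_g d g = 0 -> forall g, d g = 0.
Proof.
move=> cd d0 g; rewrite (@grading_uniq d [ffun=> 0]) ?ffunE //.
  by move=> h; rewrite ffunE; apply: grading0.
by rewrite d0 big1 // => h _; rewrite ffunE.
Qed.
End Gradings.

Lemma is_gradingP (V : zmodType) (c : G -> V -> Prop) :
  (forall g, c g 0) -> (forall g x y, c g x -> c g y -> c g (x - y)) ->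
  (forall v, exists d : {ffun G -> V},
     (forall g, c g (d g)) /\ \sum_g d g = v) ->
  (forall d : {ffun G -> V}, (forall g, c g (d g)) -> \sum_g d g = 0 ->
     forall g, d g = 0) ->
  is_grading c.
Proof.
move=> c0 cB ex un; split=> // v; have [d [cd dv]] := ex v.
exists d; split=> // d' [cd' dv']; apply/ffunP => g; apply/eqP.
rewrite -subr_eq0; have := un [ffun g => d g - d' g]; move/(_ _ _ g).
rewrite ffunE => -> //; first by move=> h; rewrite ffunE; apply: cB.
by under eq_bigr do rewrite ffunE; rewrite sumrB dv dv' subrr.
Qed.

Fact gzero_grading : is_grading (fun (_ : G) (_ : 'rV[A]_0) => True).
Proof.
apply: is_gradingP => // [v|d _ _ g]; last by rewrite [d g]thinmx0.
by exists [ffun=> 0]; split=> //; rewrite [LHS]thinmx0 [RHS]thinmx0.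
Qed.

Definition gmod0 : gmod A := GMod gzero_grading (fun _ _ _ _ _ _ => I).

Section DirectSum.
Variables P Q : gmod A.
Definition gsum_comp (g : G) (x : (P * Q)%type) := mcomp g x.1 /\ mcomp g x.2.

Fact gsum_grading : is_grading gsum_comp.
Proof.
have [gP gQ] := (mcomp_grading P, mcomp_grading Q).
apply: is_gradingP.
- by move=> g; split; apply: grading0.
- by move=> g x y [x1 x2] [y1 y2]; split; apply: gradingB.
- move=> [v w]; have [d [cd <-]] := grading_ex gP v.
  have [e [ce <-]] := grading_ex gQ w.
  exists [ffun g => (d g, e g)]; split=> [g|]; first by rewrite ffunE; split.
  under eq_bigr do rewrite ffunE.
  by rewrite [LHS]surjective_pairing (raddf_sum fst) (raddf_sum snd).
- move=> d cd d0 g; have /= := congr1 fst d0; have /= := congr1 snd d0.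
  rewrite (raddf_sum fst) (raddf_sum snd) => d2 d1.
  have h1 := grading_eq0 gP (d := [ffun g => (d g).1]).
  have h2 := grading_eq0 gQ (d := [ffun g => (d g).2]).
  rewrite [d g]surjective_pairing; congr pair.
    have := h1 _ _ g; rewrite ffunE; apply => [h|].
      by rewrite ffunE; case: (cd h).
    by rewrite -[RHS]d1; apply: eq_bigr => h _; rewrite ffunE.
  have := h2 _ _ g; rewrite ffunE; apply => [h|].
    by rewrite ffunE; case: (cd h).
  by rewrite -[RHS]d2; apply: eq_bigr => h _; rewrite ffunE.
Qed.

Fact gsumZ g h (a : A) x : gcomp g a -> gsum_comp h x -> gsum_comp (g + h) (a *: x).
Proof. by move=> ca [x1 x2]; split; apply: mcompZ. Qed.

Definition gsum : gmod A := GMod gsum_grading gsumZ.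
End DirectSum.

Section Shift.
Variables (g : G) (P : gmod A).
Definition shift_comp (h : G) (x : P) := mcomp (h - g) x.

Fact shift_grading : is_grading shift_comp.
Proof.
have gP := mcomp_grading P; apply: is_gradingP.
- by move=> h; apply: (grading0 gP).
- by move=> h x y; apply: (gradingB gP).
- move=> v; have [d [cd <-]] := grading_ex gP v.
  exists [ffun h => d (h - g)].
  split=> [h|]; first by rewrite ffunE; apply: cd.
  rewrite [RHS](reindex_inj (addIr (- g))) /=.
  by apply: eq_bigr => k _; rewrite ffunE.
- move=> d cd d0 h.
  have := grading_eq0 gP (d := [ffun h => d (h + g)]) _ _ (h - g).
  rewrite ffunE subrK; apply=> [k|].
    by rewrite ffunE; have := cd (k + g); rewrite /shift_comp addrK.
  by rewrite -[RHS]d0 [RHS](reindex_inj (addIr g)); apply: eq_bigr => k _; rewrite ffunE.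
Qed.

Fact shiftZ k h (a : A) x : gcomp k a -> shift_comp h x -> shift_comp (k + h) (a *: x).
Proof. by move=> ca cx; rewrite /shift_comp -addrA; apply: mcompZ. Qed.

Definition gshift : gmod A := GMod shift_grading shiftZ.
End Shift.

Definition greg : gmod A :=
  @GMod F G A (A^o : lmodType A) (@gcomp F G A) (gcomp_grading A) (@gcompM F G A).

Lemma gmod_isoI P Q (f : P -> Q) (h : Q -> P) : linear f ->
  graded_hom f -> graded_hom h -> cancel f h -> cancel h f -> gmod_iso P Q.
Proof.
move=> lf gf gh fK hK.
have lh : linear h by move=> a x y; rewrite -[x in LHS]hK -[y in LHS]hK -lf fK.
by exists (mk_linear lf), (mk_linear lh).
Qed.

Lemma gmod_iso_refl P : gmod_iso P P.
Proof. by apply: (gmod_isoI (f := id) (h := id)). Qed.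
Lemma gmod_iso_sym P Q : gmod_iso P Q -> gmod_iso Q P.
Proof. by case=> f [h [? ? ? ?]]; exists h, f. Qed.
Lemma gmod_iso_trans P Q R : gmod_iso P Q -> gmod_iso Q R -> gmod_iso P R.
Proof.
case=> f [h [gf gh fK hK]] [f' [h' [gf' gh' fK' hK']]].
exists (f' \o f : {linear P -> R}), (h \o h' : {linear R -> P}); split.
- by move=> g x /gf/gf'.
- by move=> g x /gh'/gh.
- exact: can_comp.
- exact: can_comp.
Qed.

Lemma gsum_iso P P' Q Q' :
  gmod_iso P P' -> gmod_iso Q Q' -> gmod_iso (gsum P Q) (gsum P' Q').
Proof.
case=> f [h [gf gh fK hK]] [f' [h' [gf' gh' fK' hK']]].
apply: (@gmod_isoI (gsum P Q) (gsum P' Q')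
  (fun x => (f x.1, f' x.2)) (fun x => (h x.1, h' x.2))).
- by move=> a x y /=; rewrite !linearP.
- by move=> g x [/gf ? /gf' ?].
- by move=> g x [/gh ? /gh' ?].
- by move=> x /=; rewrite fK fK' -surjective_pairing.
- by move=> x /=; rewrite hK hK' -surjective_pairing.
Qed.

Lemma gsumA P Q R : gmod_iso (gsum P (gsum Q R)) (gsum (gsum P Q) R).
Proof.
apply: (@gmod_isoI (gsum P (gsum Q R)) (gsum (gsum P Q) R)
  (fun x => ((x.1, x.2.1), x.2.2)) (fun x => (x.1.1, (x.1.2, x.2)))) => //.
- by move=> g x [? [? ?]].
- by move=> g x [[? ?] ?].
- by case=> x [].
- by case=> [[]].
Qed.

Lemma gsumC P Q : gmod_iso (gsum P Q) (gsum Q P).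
Proof.
apply: (@gmod_isoI (gsum P Q) (gsum Q P)
  (fun x => (x.2, x.1)) (fun x => (x.2, x.1))) => //.
- by move=> g x [].
- by move=> g x [].
- by case.
- by case.
Qed.

Lemma gsum0 P : gmod_iso (gsum gmod0 P) P.
Proof.
apply: (@gmod_isoI (gsum gmod0 P) P (fun x => x.2) (fun x => (0, x))) => //.
- by move=> g x [].
- by case=> z x /=; rewrite [z]thinmx0.
Qed.

Lemma gshift_iso g P Q : gmod_iso P Q -> gmod_iso (gshift g P) (gshift g Q).
Proof.
case=> f [h [gf gh fK hK]].
apply: (@gmod_isoI (gshift g P) (gshift g Q) f h) => //.
- exact: linearP.
- by move=> k x; apply: gf.
- by move=> k x; apply: gh.
Qed.

Lemma gshift0 P : gmod_iso (gshift 0 P) P.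
Proof.
by apply: (@gmod_isoI (gshift 0 P) P id id) => // k x /=; rewrite /shift_comp subr0.
Qed.

Lemma gshiftD g h P : gmod_iso (gshift (g + h) P) (gshift g (gshift h P)).
Proof.
by apply: (@gmod_isoI (gshift (g + h) P) (gshift g (gshift h P)) id id) => // k x;
  rewrite /= /shift_comp /= /shift_comp opprD addrA.
Qed.

Lemma gshift_zero g : gmod_iso (gshift g gmod0) gmod0.
Proof. by apply: (@gmod_isoI (gshift g gmod0) gmod0 id id). Qed.

Lemma gshift_sum g P Q :
  gmod_iso (gshift g (gsum P Q)) (gsum (gshift g P) (gshift g Q)).
Proof.
by apply: (@gmod_isoI (gshift g (gsum P Q)) (gsum (gshift g P) (gshift g Q)) id id).
Qed.

Lemma gmod0_fg : fin_gen gmod0.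
Proof. by exists 0%N, (fun=> 0) => x; exists (fun=> 0); rewrite [LHS]thinmx0 [RHS]thinmx0. Qed.
Lemma gmod0_proj : gprojective gmod0.
Proof.
move=> M N p f gp sp gf; have l0 : linear (fun _ : gmod0 => 0 : M).
  by move=> a x y; rewrite scaler0 addr0.
exists (mk_linear l0) => [g x _|x /=]; first exact: (grading0 (mcomp_grading M)).
by rewrite [x]thinmx0 !linear0.
Qed.

Lemma gsum_fg P Q : fin_gen P -> fin_gen Q -> fin_gen (gsum P Q).
Proof.
case=> n [e he] [m [e' he']]; exists (n + m)%N.
exists (fun i => match split i with inl i => (e i, 0) | inr j => (0, e' j) end).
case=> x y; have [[c Ex] [c' Ey]] := (he x, he' y).
exists (fun i => match split i with inl i => c i | inr j => c' j end).
have splitL i : split (lshift m i : 'I_(n + m)) = inl i := unsplitK (inl i).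
have splitR i : split (rshift n i : 'I_(n + m)) = inr i := unsplitK (inr i).
rewrite big_split_ord /=.
have -> : \sum_i (match split (lshift m i) with inl i => c i | inr j => c' j end
    *: match split (lshift m i) with inl i => (e i, 0) | inr j => (0, e' j) end)
    = (x, 0) :> gsum P Q.
  rewrite Ex [LHS]surjective_pairing (raddf_sum fst) (raddf_sum snd) /=.
  congr pair; first by apply: eq_bigr => i _; rewrite splitL.
  by rewrite big1 // => i _; rewrite splitL /= scaler0.
have -> : \sum_i (match split (rshift n i) with inl i => c i | inr j => c' j end
    *: match split (rshift n i) with inl i => (e i, 0) | inr j => (0, e' j) end)
    = (0, y) :> gsum P Q.
  rewrite Ey [LHS]surjective_pairing (raddf_sum fst) (raddf_sum snd) /=.
  congr pair; last by apply: eq_bigr => i _; rewrite splitR.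
  by rewrite big1 // => i _; rewrite splitR /= scaler0.
by rewrite [RHS]surjective_pairing /= addr0 add0r.
Qed.

Lemma gsum_proj P Q : gprojective P -> gprojective Q -> gprojective (gsum P Q).
Proof.
move=> pP pQ M N p f gp sp gf.
have l1 : linear (fun x : P => f (x, 0)).
  by move=> a x y; rewrite -linearP; congr (f _); rewrite [RHS]surjective_pairing /= scaler0 addr0.
have l2 : linear (fun x : Q => f (0, x)).
  by move=> a x y; rewrite -linearP; congr (f _); rewrite [RHS]surjective_pairing /= scaler0 addr0.
have [|h1 gh1 E1] := pP M N p (mk_linear l1) gp sp.
  by move=> g x cx; apply: gf; split=> //=; apply: (grading0 (mcomp_grading Q)).
have [|h2 gh2 E2] := pQ M N p (mk_linear l2) gp sp.
  by move=> g x cx; apply: gf; split=> //=; apply: (grading0 (mcomp_grading P)).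
have lh : linear (fun x : gsum P Q => h1 x.1 + h2 x.2).
  by move=> a x y /=; rewrite !linearP scalerDr addrACA.
exists (mk_linear lh).
  by move=> g x [/gh1 ? /gh2 ?]; apply: (gradingD (mcomp_grading M)).
case=> x y; move: (E1 x) (E2 y) => /= e1 e2; rewrite /= linearD e1 e2 -linearD.
by congr (f _); rewrite [LHS]surjective_pairing /= addr0 add0r.
Qed.

Lemma gshift_fg g P : fin_gen P -> fin_gen (gshift g P).
Proof. by []. Qed.

Lemma gshift_proj g P : gprojective P -> gprojective (gshift g P).
Proof.
move=> pP M N p f gp sp gf.
have [||h gh E] := pP (gshift (- g) M) (gshift (- g) N) p f _ sp.
- by move=> k x; apply: gp.
- move=> k x cx; rewrite /= /shift_comp opprK; apply: gf.
  by rewrite /= /shift_comp addrK.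
exists h => // k x cx; have := gh _ _ cx.
by rewrite /= /shift_comp opprK subrK.
Qed.

Lemma gcomp1 : gcomp 0 (1 : A).
Proof.
have gA := gcomp_grading A; have [e [ce e1]] := grading_ex gA 1.
have He h x : gcomp h x -> x = x * e 0.
  move=> cx; have := @grading_uniq _ _ gA [ffun g => x * e (g - h)]
    [ffun g => if g == h then x else 0].
  move=> /(_ _ _ _)/ffunP/(_ h); rewrite !ffunE eqxx subrr => -> //.
  - by move=> g; rewrite ffunE -{1}[g](subrK h) addrC; apply: gcompM.
  - by move=> g; rewrite ffunE; case: eqP => [->|_] //; apply: (grading0 gA).
  under eq_bigr do rewrite ffunE.
  rewrite -mulr_sumr (reindex_inj (addIr h)) /=.
  under eq_bigr do rewrite addrK.
  rewrite e1 mulr1 (bigD1 h) //= ffunE eqxx big1 ?addr0 // => g gh.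
  by rewrite ffunE (negPf gh).
suff -> : (1 : A) = e 0 by [].
by rewrite -[e 0]mul1r -{1 2}e1 mulr_suml; apply: eq_bigr => g _; apply: He (ce g).
Qed.

Lemma greg_fg : fin_gen greg.
Proof.
exists 1%N, (fun=> 1) => x; exists (fun=> x).
by rewrite big_ord1; apply/esym/mulr1.
Qed.

Lemma greg_proj : gprojective greg.
Proof.
move=> M N p f gp sp gf; have [m pm] := sp (f 1).
have [gM gN] := (mcomp_grading M, mcomp_grading N).
have [d [cd dm]] := grading_ex gM m.
have pd : p (d 0) = f 1.
  have := @grading_uniq _ _ gN [ffun g => p (d g)]
    [ffun g => if g == 0 then f 1 else 0].
  move=> /(_ _ _ _)/ffunP/(_ 0); rewrite !ffunE eqxx => -> //.
  - by move=> g; rewrite ffunE; apply: gp.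
  - move=> g; rewrite ffunE; case: eqP => [->|_]; last exact: (grading0 gN).
    exact/gf/gcomp1.
  under eq_bigr do rewrite ffunE.
  rewrite -linear_sum dm pm (bigD1 0) //= ffunE eqxx big1 ?addr0 // => g g0.
  by rewrite ffunE (negPf g0).
have lh : linear (fun a : greg => a *: d 0).
  by move=> a x y; rewrite scalerDl scalerA.
exists (mk_linear lh) => [g x cx|x /=].
  by rewrite -[g]addr0; apply: mcompZ.
by rewrite linearZ /= pd -linearZ /=; congr (f _); apply: mulr1.
Qed.

Record fgp := FGP {
  fgp_mod :> gmod A;
  fgp_fg : fin_gen fgp_mod;
  fgp_proj : gprojective fgp_mod }.

Definition fgp_iso (P Q : fgp) : Prop := gmod_iso P Q.
Definition fgp0 : fgp := FGP gmod0_fg gmod0_proj.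
Definition fgp_sum (P Q : fgp) : fgp :=
  FGP (gsum_fg (fgp_fg P) (fgp_fg Q)) (gsum_proj (@fgp_proj P) (@fgp_proj Q)).
Definition fgp_shift (g : G) (P : fgp) : fgp :=
  FGP (gshift_fg g (fgp_fg P)) (gshift_proj (g := g) (@fgp_proj P)).
Definition fgp_reg : fgp := FGP greg_fg greg_proj.

Definition iso_class : Type := classes_of fgp_iso.
Definition icls (P : fgp) : iso_class := class_of fgp_iso P.
Definition icls_zero : iso_class := icls fgp0.
Definition icls_add (x y : iso_class) : iso_class :=
  icls (fgp_sum (rep_of x) (rep_of y)).
Definition icls_act (g : G) (x : iso_class) : iso_class :=
  icls (fgp_shift g (rep_of x)).

Lemma iclsP (P Q : fgp) : icls P = icls Q <-> gmod_iso P Q.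
Proof.
apply: class_ofP.
- by move=> R; apply: gmod_iso_refl.
- by move=> R S; apply: gmod_iso_sym.
- by move=> R S T; apply: gmod_iso_trans.
Qed.

Lemma iclsE (x : iso_class) : exists P : fgp, x = icls P.
Proof. by exists (rep_of x); rewrite /icls rep_ofK. Qed.

Lemma icls_rep (P : fgp) : gmod_iso (rep_of (icls P)) P.
Proof. by apply/iclsP; apply: rep_ofK. Qed.

Lemma icls_addE (P Q : fgp) : icls_add (icls P) (icls Q) = icls (fgp_sum P Q).
Proof. by apply/iclsP/gsum_iso; apply: icls_rep. Qed.

Lemma icls_actE g (P : fgp) : icls_act g (icls P) = icls (fgp_shift g P).
Proof. by apply/iclsP/gshift_iso/icls_rep. Qed.

Fact icls_addA x y z : icls_add x (icls_add y z) = icls_add (icls_add x y) z.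
Proof.
case: (iclsE x) (iclsE y) (iclsE z) => P -> [Q ->] [R ->].
by rewrite !icls_addE; apply/iclsP/gsumA.
Qed.
Fact icls_addC x y : icls_add x y = icls_add y x.
Proof.
case: (iclsE x) (iclsE y) => P -> [Q ->].
by rewrite !icls_addE; apply/iclsP/gsumC.
Qed.
Fact icls_add0 x : icls_add icls_zero x = x.
Proof. by case: (iclsE x) => P ->; rewrite icls_addE; apply/iclsP/gsum0. Qed.
Fact icls_act0 x : icls_act 0 x = x.
Proof. by case: (iclsE x) => P ->; rewrite icls_actE; apply/iclsP/gshift0. Qed.
Fact icls_actD g h x : icls_act (g + h) x = icls_act g (icls_act h x).
Proof. by case: (iclsE x) => P ->; rewrite !icls_actE; apply/iclsP/gshiftD. Qed.
Fact icls_act_zero g : icls_act g icls_zero = icls_zero.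
Proof. by rewrite icls_actE; apply/iclsP/gshift_zero. Qed.
Fact icls_act_add g x y :
  icls_act g (icls_add x y) = icls_add (icls_act g x) (icls_act g y).
Proof.
case: (iclsE x) (iclsE y) => P -> [Q ->].
by rewrite !(icls_addE, icls_actE); apply/iclsP/gshift_sum.
Qed.

Definition K0gr_monoid : cmonoid G :=
  CMonoid icls_addA icls_addC icls_add0 icls_act0 icls_actD icls_act_zero
    icls_act_add.

Definition K0gr : triple G :=
  @Triple G (group_completion K0gr_monoid) (fun=> True)
    (fun x => exists P : K0gr_monoid, x = gc_in P)
    (gc_in (icls fgp_reg : K0gr_monoid)).
End GradedModules.

(* The group algebra R G; since G is written additively, the basis element of
   g + h is the product of those of g and h. *)
Definition grpalg (R : nzRingType) (G : finZmodType) : Type := {ffun G -> R}.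
HB.instance Definition _ R G := GRing.Zmodule.on (grpalg R G).

Section GroupAlgebra.
Variables (R : comNzRingType) (G : finZmodType).
Local Notation RG := (grpalg R G).
Implicit Types x y z : RG.

Definition ga_elt (g : G) : RG := [ffun h => (h == g)%:R].
Definition ga_mul x y : RG := [ffun g => \sum_h x h * y (g - h)].

Fact ga_mulC : commutative ga_mul.
Proof.
move=> x y; apply/ffunP => g; rewrite !ffunE.
rewrite (reindex_inj (inv_inj (@subKr _ g))) /=.
by apply: eq_bigr => h _; rewrite subKr mulrC.
Qed.
Fact ga_mulA : associative ga_mul.
Proof.
move=> x y z; apply/ffunP => g; rewrite !ffunE.
under eq_bigr => h _ do rewrite ffunE mulr_sumr.
under [RHS]eq_bigr => h _ do rewrite ffunE mulr_suml.
rewrite [RHS]exchange_big; apply: eq_bigr => h _ /=.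
rewrite [RHS](reindex_inj (addIr h)); apply: eq_bigr => k _ /=.
by rewrite addrK mulrA opprD [- k - h]addrC addrA.
Qed.
Fact ga_mul1 : left_id (ga_elt 0) ga_mul.
Proof.
move=> x; apply/ffunP => g; rewrite ffunE (bigD1 0) //= ffunE eqxx mul1r subr0.
by rewrite big1 ?addr0 // => h h0; rewrite ffunE (negPf h0) mul0r.
Qed.
Fact ga_mulDl : left_distributive ga_mul +%R.
Proof.
move=> x y z; apply/ffunP => g; rewrite !ffunE -big_split.
by apply: eq_bigr => h _; rewrite ffunE mulrDl.
Qed.
Fact ga_1neq0 : ga_elt 0 != 0.
Proof.
by apply/eqP => /ffunP/(_ 0); rewrite !ffunE eqxx; apply/eqP/oner_neq0.
Qed.
HB.instance Definition _ := GRing.Zmodule_isComNzRing.Build RG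
  ga_mulA ga_mulC ga_mul1 ga_mulDl ga_1neq0.

Lemma ga_eltM g h : ga_elt (g + h) = ga_elt g * ga_elt h.
Proof.
apply/ffunP => k; rewrite [RHS]ffunE (bigD1 g) //= !ffunE eqxx mul1r.
rewrite big1 ?addr0 => [|l lg]; last by rewrite ffunE (negPf lg) mul0r.
by rewrite subr_eq addrC.
Qed.

Definition ga_act (g : G) (z : RG) : RG := ga_elt g * z.

Fact ga_act0 z : ga_act 0 z = z. Proof. exact: mul1r. Qed.
Fact ga_actD g h z : ga_act (g + h) z = ga_act g (ga_act h z).
Proof. by rewrite /ga_act ga_eltM mulrA. Qed.
Fact ga_act_zero g : ga_act g 0 = 0. Proof. exact: mulr0. Qed.
Fact ga_act_add g z t : ga_act g (z + t) = ga_act g z + ga_act g t.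
Proof. exact: mulrDr. Qed.

Definition ga_zgmod : zgmod G :=
  ZGMod (zg_cmonoid := @CMonoid G RG 0 +%R ga_act (@addrA _) (@addrC _)
    (@add0r _) ga_act0 ga_actD ga_act_zero ga_act_add) (@addNr _).

Definition ga_bar (z : RG) : RG := [ffun g => z (- g)].
End GroupAlgebra.

Section Supports.
Variable G : finZmodType.
Local Notation QG := (grpalg rat G).
(* The characters of G with values in algC, that is in an algebraic closure of
   the rationals; see dualP. *)
Local Notation dual := (Iirr [set: G]).

Lemma dual_hom (i : dual) :
  'chi_i 0 = 1 /\ forall g h : G, 'chi_i (g + h) = 'chi_i g * 'chi_i h.
Proof.
have cG : abelian [set: G] by apply/centsP => x _ y _; apply: addrC.
have lin : 'chi_i \is a linear_char by apply/char_abelianP.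
split; first exact: lin_char1.
by move=> g h; apply: (lin_charM lin); rewrite inE.
Qed.

Lemma dualP (f : G -> algC) : f 0 = 1 ->
  (forall g h, f (g + h) = f g * f h) -> exists! i : dual, f =1 'chi_i.
Proof.
move=> f0 fD.
have repf : mx_repr [set: G] (fun g => (f g)%:M : 'M[algC]_1).
  by split=> [|g h _ _]; rewrite ?f0 // -scalar_mxM -fD.
pose phi := cfRepr (MxRepresentation repf).
have phiE g : phi g = f g by rewrite cfunE inE mulr1n mxtrace_scalar.
have phi_lin : phi \is a linear_char.
  by rewrite qualifE /= cfRepr_char /= phiE f0 eqxx.
have /irrP[i Ei] := lin_char_irr phi_lin.
exists i; split=> [g|j Ej]; first by rewrite -Ei phiE.
by apply/irr_inj; rewrite -Ei; apply/cfunP => g; rewrite phiE Ej.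
Qed.

(* Galois orbits in the dual: aut_Iirr u is post-composition with u, and every
   ring endomorphism u of algC is an automorphism (algC_autK, algC_invautK). *)
Definition gal_orbit (i : dual) : {set dual} :=
  [set j | `[< exists u : {rmorphism algC -> algC}, j = aut_Iirr u i >]].
Definition gal_orbits : {set {set dual}} := [set gal_orbit i | i : dual].

(* e_j; getCrat is the inverse of ratr on the rational elements of algC, to
   which the coefficients belong when j is a Galois orbit (idemE). *)
Definition idem (j : {set dual}) : QG :=
  [ffun g : G => getCrat (\sum_(i in j) #|G|%:R^-1 * ('chi_i g)^-1)].

Lemma gal_orbit_aut (u : {rmorphism algC -> algC}) (j : {set dual}) :
  j \in gal_orbits -> [set aut_Iirr u i | i in j] = j.
Proof.
case/imsetP => k _ ->; apply/eqP; rewrite eqEcard; apply/andP; split; last first.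
  by rewrite card_imset //; apply: aut_Iirr_inj.
apply/subsetP => _ /imsetP[i + ->]; rewrite !inE => /asboolP[v ->].
apply/asboolP; exists (u \o v : {rmorphism algC -> algC}).
by apply: irr_inj; rewrite !aut_IirrE; apply/cfunP => g; rewrite !cfunE.
Qed.

Lemma idemE (j : {set dual}) (g : G) : j \in gal_orbits ->
  ratr (idem j g) = \sum_(i in j) #|G|%:R^-1 * ('chi_i g)^-1 :> algC.
Proof.
move=> jo; rewrite ffunE; apply: getCratK.
set al := \sum_(i in j) _.
have fix_al (u : {rmorphism algC -> algC}) : u al = al.
  rewrite /al -{2}(gal_orbit_aut u jo) big_imset /=; last first.
    by move=> ? ? _ _; apply: aut_Iirr_inj.
  rewrite rmorph_sum; apply: eq_bigr => i _.
  by rewrite aut_IirrE cfunE rmorphM !fmorphV rmorph_nat.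
have [Qn galQn [QnC gQnC [_ _ QnG]]] := group_num_field_exists [set: G].
have [b Db] : exists b, QnC b = al.
  have Qchi (i : dual) : exists b, QnC b = 'chi_i g.
    by have [|b <-] := QnG _ _ _ (irr_char i) g; [apply: order_dvdG; rewrite inE | exists b].
  have [f Hf] := fin_all_exists Qchi.
  exists (\sum_(i in j) #|G|%:R^-1 * (f i)^-1); rewrite rmorph_sum.
  by apply: eq_bigr => i _; rewrite rmorphM !fmorphV rmorph_nat Hf.
have : b \in (1%VS : {vspace Qn}).
  have <- := galois_fixedField galQn.
  apply/fixedFieldP; first exact: memvf.
  move=> nu _; apply: (fmorph_inj QnC).
  by case: (gQnC nu) => u Hu; rewrite Hu Db fix_al.
case/vlineP => q Eb; apply/CratP; exists q; rewrite -Db Eb.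
exact: (fmorph_eq_rat (QnC \o in_alg Qn) q).
Qed.
Definition supp (z : QG) : {set {set dual}} :=
  [set j in gal_orbits | idem j * z != 0].

Definition pi_ (S : {set {set dual}}) (z : QG) : QG := \sum_(j in S) idem j * z.

(* v is the inverse of z in the ring L_S, the image of pi_ S, whose identity
   is pi_ S 1. *)
Definition inverse_in (S : {set {set dual}}) (z v : QG) : Prop :=
  (exists w, v = pi_ S w) /\ v * z = pi_ S 1.

Definition ga_nat (x : {ffun G -> nat}) : QG := [ffun g => (x g)%:R].
Definition ga_int (x : {ffun G -> int}) : QG := [ffun g => (x g)%:~R].

(* a i stands for a_(i+1), so that b_ i is the product of the conjugates of
   a_1, up to a_i. *)
Variables (S : {set {set dual}}) (x0 : {ffun G -> nat}).
Variable a : nat -> {ffun G -> nat}.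

Definition standard_form : Prop :=
  (forall i, supp (ga_nat (a i)) = S) /\ supp (ga_nat x0) \subset S.

Definition b_ (i : nat) : QG := \prod_(k < i) ga_bar (ga_nat (a k)).

Definition K_pos (z : QG) : Prop :=
  exists (i : nat) (v : QG) (y : {ffun G -> nat}),
    [/\ (0 < i)%N, inverse_in S (pi_ S (b_ i)) v & z = v * pi_ S (ga_nat y)].

Definition K_all (z : QG) : Prop :=
  exists (i : nat) (v : QG) (y : {ffun G -> int}),
    [/\ (0 < i)%N, inverse_in S (pi_ S (b_ i)) v & z = v * pi_ S (ga_int y)].

Definition K_triple : triple G :=
  @Triple G (ga_zgmod rat G) K_all K_pos (pi_ S (ga_bar (ga_nat x0))).
End Supports.

Section DirectLimit.
Variables (F : fieldType) (G : finZmodType) (R : nat -> galg F G).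
Variable f : forall i, {lrmorphism R i -> R i.+1}.

(* The direct limit of R 0 -> R 1 -> ..., as the set of sequences that are
   compatible with the maps f i from some index on, two of them being identified
   when they agree from some index on: each class comes from an element of some
   R i (dlim_surj), and elements of R i and R j define the same class iff their
   images in some R k agree (dlim_inP). *)
Record thread := Thread {
  th :> forall i, R i;
  threadP : exists N, forall i, (N <= i)%N -> th i.+1 = f i (th i) }.

HB.instance Definition _ := gen_eqMixin thread.
HB.instance Definition _ := gen_choiceMixin thread.

Definition thread_eq (s t : thread) : bool :=
  `[< exists N, forall i, (N <= i)%N -> s i = t i >].

Fact thread_eq_refl : reflexive thread_eq.
Proof. by move=> s; apply/asboolP; exists 0%N. Qed.
Fact thread_eq_sym : symmetric thread_eq.
Proof.
by move=> s t; apply/asboolP/asboolP => -[N H]; exists N => i /H.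
Qed.
Fact thread_eq_trans : transitive thread_eq.
Proof.
move=> t s u /asboolP[N H] /asboolP[M K]; apply/asboolP; exists (maxn N M) => i.
by rewrite geq_max => /andP[/H -> /K ->].
Qed.
Canonical thread_equiv :=
  EquivRel thread_eq thread_eq_refl thread_eq_sym thread_eq_trans.

Definition dlim : Type := {eq_quot thread_equiv}%qT.
HB.instance Definition _ := Choice.on dlim.
Definition dcls (s : thread) : dlim := \pi_({eq_quot thread_equiv})%qT s.

Lemma dclsP s t :
  dcls s = dcls t <-> exists N, forall i, (N <= i)%N -> s i = t i.
Proof.
split=> [/eqmodP/asboolP //|H]; by apply/eqmodP/asboolP.
Qed.
Lemma dclsE (x : dlim) : exists s, x = dcls s.
Proof. by exists (repr x); rewrite /dcls reprK. Qed.
Lemma repr_dcls s : exists N, forall i, (N <= i)%N -> (repr (dcls s) : thread) i = s i.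
Proof. by apply/dclsP; apply: (reprK (dcls s)). Qed.

Fact tconst_subproof (c : forall i, R i) : (forall i, c i.+1 = f i (c i)) ->
  exists N, forall i, (N <= i)%N -> c i.+1 = f i (c i).
Proof. by exists 0%N. Qed.
Definition thread0 := @Thread (fun=> 0) (tconst_subproof (fun i => esym (rmorph0 (f i)))).
Definition thread1 := @Thread (fun=> 1) (tconst_subproof (fun i => esym (rmorph1 (f i)))).

Fact tN_subproof (s : thread) :
  exists N, forall i, (N <= i)%N -> - s i.+1 = f i (- s i).
Proof. by have [N H] := threadP s; exists N => i /H ->; rewrite rmorphN. Qed.
Definition tN s := Thread (tN_subproof s).

Fact tD_subproof (s t : thread) :
  exists N, forall i, (N <= i)%N -> s i.+1 + t i.+1 = f i (s i + t i).
Proof.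
have [[N H] [M K]] := (threadP s, threadP t); exists (maxn N M) => i.
by rewrite geq_max => /andP[/H -> /K ->]; rewrite rmorphD.
Qed.
Definition tD s t := Thread (tD_subproof s t).

Fact tM_subproof (s t : thread) :
  exists N, forall i, (N <= i)%N -> s i.+1 * t i.+1 = f i (s i * t i).
Proof.
have [[N H] [M K]] := (threadP s, threadP t); exists (maxn N M) => i.
by rewrite geq_max => /andP[/H -> /K ->]; rewrite rmorphM.
Qed.
Definition tM s t := Thread (tM_subproof s t).

Fact tZ_subproof (k : F) (s : thread) :
  exists N, forall i, (N <= i)%N -> k *: s i.+1 = f i (k *: s i).
Proof. by have [N H] := threadP s; exists N => i /H ->; rewrite linearZ. Qed.
Definition tZ k s := Thread (tZ_subproof k s).

Definition dadd (x y : dlim) : dlim := dcls (tD (repr x) (repr y)).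
Definition dopp (x : dlim) : dlim := dcls (tN (repr x)).
Definition dmul (x y : dlim) : dlim := dcls (tM (repr x) (repr y)).
Definition dscale k (x : dlim) : dlim := dcls (tZ k (repr x)).

Lemma daddE s t : dadd (dcls s) (dcls t) = dcls (tD s t).
Proof.
apply/dclsP; have [[N H] [M K]] := (repr_dcls s, repr_dcls t).
by exists (maxn N M) => i; rewrite geq_max /= => /andP[/H -> /K ->].
Qed.
Lemma dmulE s t : dmul (dcls s) (dcls t) = dcls (tM s t).
Proof.
apply/dclsP; have [[N H] [M K]] := (repr_dcls s, repr_dcls t).
by exists (maxn N M) => i; rewrite geq_max /= => /andP[/H -> /K ->].
Qed.
Lemma doppE s : dopp (dcls s) = dcls (tN s).
Proof. by apply/dclsP; have [N H] := repr_dcls s; exists N => i /= /H ->. Qed.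
Lemma dscaleE k s : dscale k (dcls s) = dcls (tZ k s).
Proof. by apply/dclsP; have [N H] := repr_dcls s; exists N => i /= /H ->. Qed.

Lemma dcls_ext (s t : thread) : (forall i, s i = t i) -> dcls s = dcls t.
Proof. by move=> E; apply/dclsP; exists 0%N. Qed.

Fact daddA : associative dadd.
Proof.
move=> x y z; case: (dclsE x) (dclsE y) (dclsE z) => s -> [t ->] [u ->].
by rewrite !daddE; apply: dcls_ext => i /=; rewrite addrA.
Qed.
Fact daddC : commutative dadd.
Proof.
move=> x y; case: (dclsE x) (dclsE y) => s -> [t ->].
by rewrite !daddE; apply: dcls_ext => i /=; rewrite addrC.
Qed.
Fact dadd0 : left_id (dcls thread0) dadd.
Proof.
by move=> x; case: (dclsE x) => s ->; rewrite daddE; apply: dcls_ext => i /=;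
  rewrite add0r.
Qed.
Fact daddN : left_inverse (dcls thread0) dopp dadd.
Proof.
by move=> x; case: (dclsE x) => s ->; rewrite doppE daddE; apply: dcls_ext => i /=;
  rewrite addNr.
Qed.
HB.instance Definition _ := GRing.isZmodule.Build dlim daddA daddC dadd0 daddN.

Fact dmulA : associative dmul.
Proof.
move=> x y z; case: (dclsE x) (dclsE y) (dclsE z) => s -> [t ->] [u ->].
by rewrite !dmulE; apply: dcls_ext => i /=; rewrite mulrA.
Qed.
Fact dmul1l : left_id (dcls thread1) dmul.
Proof.
by move=> x; case: (dclsE x) => s ->; rewrite dmulE; apply: dcls_ext => i /=;
  rewrite mul1r.
Qed.
Fact dmul1r : right_id (dcls thread1) dmul.
Proof.
by move=> x; case: (dclsE x) => s ->; rewrite dmulE; apply: dcls_ext => i /=;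
  rewrite mulr1.
Qed.
Fact dmulDl : left_distributive dmul dadd.
Proof.
move=> x y z; case: (dclsE x) (dclsE y) (dclsE z) => s -> [t ->] [u ->].
by rewrite !(dmulE, daddE); apply: dcls_ext => i /=; rewrite mulrDl.
Qed.
Fact dmulDr : right_distributive dmul dadd.
Proof.
move=> x y z; case: (dclsE x) (dclsE y) (dclsE z) => s -> [t ->] [u ->].
by rewrite !(dmulE, daddE); apply: dcls_ext => i /=; rewrite mulrDr.
Qed.
Fact done_neq0 : dcls thread1 != 0.
Proof.
apply/eqP => /dclsP[N /(_ N (leqnn N))] /=.
by apply/eqP; apply: oner_neq0.
Qed.
HB.instance Definition _ := GRing.Zmodule_isNzRing.Build dlim
  dmulA dmul1l dmul1r dmulDl dmulDr done_neq0.

Fact dscaleA k l x : dscale k (dscale l x) = dscale (k * l) x.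
Proof.
by case: (dclsE x) => s ->; rewrite !dscaleE; apply: dcls_ext => i /=;
  rewrite scalerA.
Qed.
Fact dscale1 : left_id 1 dscale.
Proof.
by move=> x; case: (dclsE x) => s ->; rewrite !dscaleE; apply: dcls_ext => i /=;
  rewrite scale1r.
Qed.
Fact dscaleDr : right_distributive dscale dadd.
Proof.
move=> k x y; case: (dclsE x) (dclsE y) => s -> [t ->].
by rewrite !(dscaleE, daddE); apply: dcls_ext => i /=; rewrite scalerDr.
Qed.
Fact dscaleDl x k l : dscale (k + l) x = dadd (dscale k x) (dscale l x).
Proof.
case: (dclsE x) => s ->.
by rewrite !(dscaleE, daddE); apply: dcls_ext => i /=; rewrite scalerDl.
Qed.
HB.instance Definition _ := GRing.Zmodule_isLmodule.Build F dlim
  dscaleA dscale1 dscaleDr dscaleDl.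

Fact dscaleAl (k : F) (x y : dlim) : k *: (x * y) = k *: x * y.
Proof.
case: (dclsE x) (dclsE y) => s -> [t ->].
change (dscale k (dmul (dcls s) (dcls t)) = dmul (dscale k (dcls s)) (dcls t)).
by rewrite !(dscaleE, dmulE); apply: dcls_ext => i /=; rewrite scalerAl.
Qed.
Fact dscaleAr (k : F) (x y : dlim) : k *: (x * y) = x * (k *: y).
Proof.
case: (dclsE x) (dclsE y) => s -> [t ->].
change (dscale k (dmul (dcls s) (dcls t)) = dmul (dcls s) (dscale k (dcls t))).
by rewrite !(dscaleE, dmulE); apply: dcls_ext => i /=; rewrite scalerAr.
Qed.
HB.instance Definition _ := GRing.Lmodule_isLalgebra.Build F dlim dscaleAl.
HB.instance Definition _ := GRing.Lalgebra_isAlgebra.Build F dlim dscaleAr.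

(* The canonical map R i -> dlim sends z to the thread z, f i z, f (i+1) (f i z),
   etc., extended by junk below i. *)
Definition cast_to i k (z : R i) : R k :=
  match i =P k with ReflectT e => ecast k (R k) e z | ReflectF _ => 0 end.
Fixpoint tfrom i (z : R i) k : R k :=
  if k is k'.+1 then
    if i == k'.+1 then cast_to k'.+1 z else f k' (tfrom z k')
  else cast_to 0 z.

Lemma cast_toK i (z : R i) : cast_to i z = z.
Proof. by rewrite /cast_to; case: eqP => // e; rewrite eq_axiomK. Qed.
Lemma tfrom_id i (z : R i) : tfrom z i = z.
Proof. by case: i z => [|i] z /=; rewrite ?eqxx cast_toK. Qed.
Lemma tfromS i (z : R i) k : (i <= k)%N -> tfrom z k.+1 = f k (tfrom z k).
Proof. by move=> ik /=; rewrite ltn_eqF. Qed.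

Definition dlim_in i (z : R i) : dlim :=
  dcls (Thread (ex_intro _ i (tfromS z))).

Lemma dlim_inS i (z : R i) : dlim_in (f i z) = dlim_in z.
Proof.
have E k : (i < k)%N -> tfrom (f i z) k = tfrom z k.
  elim: k => // k IHk; rewrite ltnS leq_eqVlt => /predU1P[<-|ik].
    by rewrite tfrom_id tfromS // tfrom_id.
  by rewrite !tfromS ?IHk // ltnW.
by apply/dclsP; exists i.+1.
Qed.

Lemma dlim_surj x : exists i (z : R i), x = dlim_in z.
Proof.
have [s ->] := dclsE x; have [N H] := threadP s; exists N, (s N).
have E k : s (N + k)%N = tfrom (s N) (N + k)%N.
  elim: k => [|k IHk]; first by rewrite addn0 tfrom_id.
  by rewrite addnS H ?leq_addr // tfromS ?leq_addr // IHk.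
by apply/dclsP; exists N => i Ni; have := E (i - N)%N; rewrite subnKC.
Qed.

Lemma dlim_inP i j (z : R i) (w : R j) : dlim_in z = dlim_in w <->
  exists k, [/\ (i <= k)%N, (j <= k)%N & tfrom z k = tfrom w k].
Proof.
split=> [/dclsP[N H]|[k [ik jk E]]].
  exists (maxn N (maxn i j)); split; try by rewrite !leq_max leqnn !orbT.
  by apply: H; rewrite leq_max leqnn.
have El l : tfrom z (k + l)%N = tfrom w (k + l)%N.
  elim: l => [|l IHl]; first by rewrite addn0.
  by rewrite addnS !tfromS ?IHl // (leq_trans _ (leq_addr l k)).
by apply/dclsP; exists k => l kl /=; have := El (l - k)%N; rewrite subnKC.
Qed.

Definition dcomp (g : G) (x : dlim) : Prop :=
  exists s : thread, x = dcls s /\ exists N, forall i, (N <= i)%N -> gcomp g (s i).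

Hypothesis fgr : forall i g x, gcomp g x -> gcomp g (f i x).

Fact dlim_grading : is_grading dcomp.
Proof.
have gR i := gcomp_grading (R i).
apply: is_gradingP.
- by move=> g; exists thread0; split=> //; exists 0%N => i _; apply: (grading0 (gR i)).
- move=> g _ _ [s [-> [N H]]] [t [-> [M K]]].
  exists (tD s (tN t)); split.
    by change (dadd (dcls s) (dopp (dcls t)) = dcls (tD s (tN t)));
      rewrite doppE daddE.
  exists (maxn N M) => i; rewrite geq_max => /andP[Ni Mi].
  by apply: (gradingB (gR i)); [apply: H | apply: K].
- move=> x; have [s ->] := dclsE x.
  have [N H] := threadP s.
  pose d i := sval (cid (grading_ex (gR i) (s i))).
  have dP i : (forall g, gcomp g (d i g)) /\ \sum_g d i g = s i.
    by rewrite /d; case: cid.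
  have dS g : exists N, forall i, (N <= i)%N -> d i.+1 g = f i (d i g).
    exists N => i Ni; have [c1 e1] := dP i; have [c2 e2] := dP i.+1.
    have := @grading_uniq _ _ _ (gR i.+1) (d i.+1) [ffun g => f i (d i g)].
    move=> -> //; first by rewrite ffunE.
      by move=> h; rewrite ffunE; apply: fgr.
    rewrite e2 H // -e1 raddf_sum.
    by apply: eq_bigr => h _; rewrite ffunE.
  pose D g := @Thread (fun i => d i g) (dS g).
  exists [ffun g => dcls (D g)]; split=> [g|].
    by rewrite ffunE; exists (D g); split=> //; exists 0%N => i _; case: (dP i).
  under eq_bigr do rewrite ffunE.
  have sumD (r : seq G) : exists t : thread, \sum_(g <- r) dcls (D g) = dcls t /\
      forall i, t i = \sum_(g <- r) d i g.
    elim: r => [|g r [t [E Et]]].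
      by exists thread0; split=> [|i]; rewrite big_nil.
    exists (tD (D g) t); split=> [|i]; last by rewrite big_cons /= Et.
    by rewrite big_cons E; apply: daddE.
  have [t [-> Et]] := sumD (index_enum G).
  by apply: dcls_ext => i; rewrite Et; case: (dP i).
- move=> e ce e0 g.
  pose s h := sval (cid (ce h)).
  have sP h : e h = dcls (s h) /\
      exists N, forall i, (N <= i)%N -> gcomp h (s h i).
    by rewrite /s; case: cid.
  have sumD (r : seq G) : exists t : thread, \sum_(g <- r) e g = dcls t /\
      forall i, t i = \sum_(g <- r) s g i.
    elim: r => [|h r [t [E Et]]].
      by exists thread0; split=> [|i]; rewrite big_nil.
    exists (tD (s h) t); split=> [|i]; last by rewrite big_cons /= Et.
    by rewrite big_cons E; case: (sP h) => -> _; apply: daddE.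
  have [t [Et ts]] := sumD (index_enum G).
  have : dcls t = dcls thread0 by rewrite -Et e0.
  move=> /dclsP[N HN].
  have /choice[M HM] : forall h, exists N, forall i, (N <= i)%N -> gcomp h (s h i).
    by move=> h; case: (sP h).
  rewrite (sP g).1; apply/dclsP; exists (maxn N (\max_h M h)) => i.
  rewrite geq_max => /andP[Ni Mi] /=.
  have := grading_eq0 (gR i) (d := [ffun h => s h i]) _ _ g.
  rewrite ffunE; apply=> [h|].
    by rewrite ffunE; apply: (HM h i); apply: leq_trans Mi; apply: leq_bigmax.
  by under eq_bigr do rewrite ffunE; rewrite -ts HN.
Qed.

Fact dcompZ g k x : dcomp g x -> dcomp g (k *: x).
Proof.
case=> s [-> [N H]]; exists (tZ k s); split; first exact: dscaleE.
by exists N => i /H; apply: gcompZ.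
Qed.
Fact dcompM g h x y : dcomp g x -> dcomp h y -> dcomp (g + h) (x * y).
Proof.
case=> s [-> [N H]] [t [-> [M K]]]; exists (tM s t); split; first exact: dmulE.
exists (maxn N M) => i; rewrite geq_max => /andP[/H ? /K ?]; exact: gcompM.
Qed.

Definition dlim_galg : galg F G := GAlg dlim_grading dcompZ dcompM.
End DirectLimit.

Section MatrixAlgebras.
Variables (F : fieldType) (G : finZmodType).

(* A nonempty tuple (g_0, ..., g_n) of elements of G. *)
Record gtuple := GTuple { gt_len : nat; gt_deg :> 'I_gt_len.+1 -> G }.

Section Elementary.
Variable t : gtuple.
Definition mx_comp (g : G) (A : 'M[F]_((gt_len t).+1)) : Prop :=
  forall i j, A i j != 0 -> t i - t j = g.

Fact mx_grading : is_grading mx_comp.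
Proof.
apply: is_gradingP.
- by move=> g i j; rewrite mxE eqxx.
- move=> g A B cA cB i j; rewrite !mxE => AB.
  have [A0|/cA //] := eqVneq (A i j) 0.
  by apply: cB; apply: contraNneq AB => ->; rewrite A0 subrr.
- move=> A; exists [ffun g => \matrix_(i, j) if t i - t j == g then A i j else 0].
  split=> [g i j|]; first by rewrite ffunE mxE; case: (t i - t j =P g) => // _; rewrite eqxx.
  apply/matrixP => i j; rewrite summxE (bigD1 (t i - t j)) //= ffunE mxE eqxx.
  by rewrite big1 ?addr0 // => g; rewrite ffunE mxE eq_sym => /negPf ->.
- move=> d cd d0 g; apply/matrixP => i j; rewrite mxE.
  have [E|ne] := eqVneq (t i - t j) g; last first.
    by apply/eqP; apply: contraNT ne => /cd ->.
  move/matrixP/(_ i j): d0; rewrite summxE mxE (bigD1 g) //= big1 ?addr0 // => h.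
  by move=> hg; apply/eqP; apply: contraNT hg => /cd <-; rewrite E.
Qed.

Fact mx_compZ g k A : mx_comp g A -> mx_comp g (k *: A).
Proof. by move=> cA i j; rewrite mxE mulf_eq0 negb_or => /andP[_ /cA]. Qed.

Fact mx_compM g h A B : mx_comp g A -> mx_comp h B -> mx_comp (g + h) (A * B).
Proof.
move=> cA cB i j; rewrite mxE => AB.
have [k ne0] : exists k, A i k * B k j != 0.
  apply/existsP; apply: contraNT AB => /existsPn H; apply/eqP/big1 => k _.
  by apply/eqP/negPn/H.
move: ne0; rewrite mulf_eq0 negb_or => /andP[/cA <- /cB <-].
by rewrite addrA subrK.
Qed.

Definition mx_galg : galg F G := GAlg mx_grading mx_compZ mx_compM.
End Elementary.

(* A tuple in which each g occurs x g times; the junk value at x = 0 is the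
   tuple (0). *)
Definition gseq (x : {ffun G -> nat}) : seq G :=
  flatten [seq nseq (x g) g | g <- enum G].

Lemma count_gseq x g : count_mem g (gseq x) = x g.
Proof.
rewrite /gseq count_flatten -map_comp sumnE big_map big_enum /=.
rewrite (bigD1 g) //= count_nseq /= eqxx mul1n big1 ?addn0 // => h hg.
by rewrite count_nseq /= (negPf hg).
Qed.

Definition gtuple_of (x : {ffun G -> nat}) : gtuple :=
  @GTuple (size (gseq x)).-1 (fun i => nth 0 (gseq x) i).

(* The grading of the tensor product of the algebras of s and t, when it is
   identified with a matrix algebra by the Kronecker product tensmx. *)
Definition gtens (s t : gtuple) : gtuple :=
  @GTuple ((gt_len s).+1 * (gt_len t).+1).-1
    (fun k : 'I_((gt_len s).+1 * (gt_len t).+1) =>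
       s (mxtens_unindex k).1 + t (mxtens_unindex k).2).

Section TensorOne.
Variables s t : gtuple.
Local Notation n := (gt_len s).
Local Notation m := (gt_len t).

Definition tens1 (A : mx_galg s) : mx_galg (gtens s t) :=
  tensmx (A : 'M[F]_n.+1) (1%:M : 'M[F]_m.+1).

Fact tens1_linear : linear tens1.
Proof. by move=> k A B; apply/matrixP => i j; rewrite !mxE mulrDl mulrA. Qed.
Fact tens1_monoid : monoid_morphism tens1.
Proof.
split=> [|A B].
  apply/matrixP => i j; rewrite !mxE -natrM mulnb; congr (_%:R).
  exact: (congr1 nat_of_bool (can_eq (@mxtens_unindexK n.+1 m.+1) i j)).
have := tensmx_mul (A : 'M[F]_n.+1) (1%:M : 'M[F]_m.+1) B 1%:M.
by rewrite mul1mx => E; apply: esym E.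
Qed.

Definition tens1_hom : {lrmorphism mx_galg s -> mx_galg (gtens s t)} :=
  HB.pack tens1
    (GRing.isLinear.Build F (mx_galg s) (mx_galg (gtens s t)) *:%R tens1
       tens1_linear)
    (GRing.isMonoidMorphism.Build (mx_galg s) (mx_galg (gtens s t)) tens1
       tens1_monoid).

Fact tens1_graded g (A : mx_galg s) : gcomp g A -> gcomp g (tens1_hom A).
Proof.
move=> cA i j; rewrite /= !mxE mulf_eq0 negb_or => /andP[/cA <-].
case: ((mxtens_unindex (i : 'I_(n.+1 * m.+1))).2 =P _) => [E _|_]; last first.
  by rewrite eqxx.
have aux (p q r l : G) : q = l -> p + q - (r + l) = p - r.
  by move=> ->; rewrite opprD addrACA subrr addr0.
exact/aux/(congr1 t E).
Qed.
End TensorOne.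

Section InfiniteProduct.
Variables (x0 : {ffun G -> nat}) (a : nat -> {ffun G -> nat}).

Fixpoint stage (i : nat) : gtuple :=
  if i is k.+1 then gtens (stage k) (gtuple_of (a k)) else gtuple_of x0.

(* The infinite product of M_(x_0), M_(a_1), M_(a_2), etc.; a k is a_(k+1). *)
Definition M_inf : galg F G :=
  @dlim_galg F G (fun i => mx_galg (stage i))
    (fun i => tens1_hom (stage i) (gtuple_of (a i)))
    (fun i => @tens1_graded (stage i) (gtuple_of (a i))).
End InfiniteProduct.
End MatrixAlgebras.

(* Main.v *)
Require Import Defs.
From HB Require Import structures.
From mathcomp Require Import all_boot all_order all_fingroup all_algebra.
From mathcomp Require Import all_solvable all_field all_character.
From mathcomp Require Import boolp mxtens.

(** Let A be the infinite product, the union of the graded matrix algebras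
    R_i = M_(x_i), let t_i be the degree tuple of R_i, let E_pq be its matrix
    units, and let c_i be the image in A of the matrix unit E_00 of R_i. It is
    a homogeneous idempotent of degree 0; put V_i = (A c_i)^[t_i(0)], the module
    induced from the column module of R_i.

    Generators. A finitely generated projective graded P has a dual basis (w_k),
    (f_k), and the finitely many entries f_l(w_k) of its Gram matrix come from
    some R_i. Multiplying by the E_0p and E_p0 of R_i turns this matrix into a
    homogeneous idempotent matrix with coefficients in the field, which factors
    through its rank; so P is a sum of shifts of V_i
    ([homogeneous_idempotent_factor], [frame_of_gram], [frame_ex]). Such a
    decomposition is recorded as a [frame], and the element of Z_(>=0)G that
    counts its shifts is [frame_mult].

    Relations. V_i is the sum of the shifts of V_(i+1) by the inverses of the
    degrees of M_(a_(i+1)), because c_i is the sum of the E_qq of R_(i+1) that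
    lie below it; so passing to the next stage multiplies the multiplicities by
    the conjugate of a_(i+1) ([split_succ], [frame_mult_refine]). Two frames of
    one module at one stage have transition matrices with entries in some later
    stage; there these are mutually inverse homogeneous matrices of scalars, so
    the multiplicities agree ([frame_val_stage]). Hence K_0^+ is the direct limit
    of Z_(>=0)G under the multiplications by the conjugates of the a_i.

    Localization. Dividing a stage i multiplicity by pi_S(b_i) gives an
    invariant of P with values in L_S ([frame_val_uniq]). Evaluating at the
    characters of G shows that pi_S(b_i) is invertible in L_S
    ([inverse_in_ex]) and that whatever pi_S kills is annihilated by the
    conjugates of the a_i ([localizer_ker]); so modules with the same invariant
    have the same multiplicities one stage later, and are isomorphic. The
    invariant embeds K_0^+ in L_S with image K^+(A); this makes K_0^+
    cancellative, and its group completion becomes the set K(A) of differences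
    ([completion_iso]). For P = A the stage 0 multiplicity is the conjugate of
    x_0, as A is the sum of the A E_pp ([regular_frame]). *)

Set Implicit Arguments.
Unset Strict Implicit.
Unset Printing Implicit Defensive.
Import GRing.Theory Num.Theory.
Local Open Scope ring_scope.

(** * Rational group algebras and characters *)

Section Characters.
Variable G : finZmodType.
Local Notation QG := (grpalg rat G).
Local Notation dual := (Iirr [set: G]).
Implicit Types (x y z : QG) (i j : dual) (g h : G).

(** The character i extended linearly to the group algebra. *)
Definition char_eval i z : algC := \sum_g ratr (z g) * 'chi_i g.

Lemma char0 i : 'chi_i (0 : G) = 1.
Proof. by case: (dual_hom i). Qed.

Lemma charD i g h : 'chi_i (g + h) = 'chi_i g * 'chi_i h.
Proof. by case: (dual_hom i). Qed.

Lemma char_lin i : 'chi_i \is a linear_char.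
Proof. by apply/char_abelianP/centsP => x _ y _; apply: addrC. Qed.

Lemma charN i g : 'chi_i (- g) = ('chi_i g)^*.
Proof. by apply: (lin_charV_conj (char_lin i)); rewrite inE. Qed.

Fact char_eval_zmod i : zmod_morphism (char_eval i).
Proof.
move=> x y; rewrite /char_eval -sumrB; apply: eq_bigr => g _.
by rewrite !ffunE rmorphB mulrBl.
Qed.

Fact char_eval_monoid i : monoid_morphism (char_eval i).
Proof.
split=> [|x y].
  rewrite /char_eval (bigD1 0) //= ffunE eqxx rmorph1 char0 mulr1 big1 ?addr0 //.
  by move=> g g0; rewrite ffunE (negPf g0) rmorph0 mul0r.
rewrite /char_eval big_distrlr /=.
under eq_bigr => g _ do rewrite ffunE rmorph_sum mulr_suml.
rewrite exchange_big; apply: eq_bigr => h _ /=.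
rewrite (reindex_inj (addIr h)) /=; apply: eq_bigr => g _.
by rewrite rmorphM /= addrK charD [in LHS](mulrC ('chi_i g)) mulrACA.
Qed.

HB.instance Definition _ i :=
  GRing.isZmodMorphism.Build QG algC (char_eval i) (char_eval_zmod i).
HB.instance Definition _ i :=
  GRing.isMonoidMorphism.Build QG algC (char_eval i) (char_eval_monoid i).

(** By the orthogonality of columns, the values at all characters determine the
    coefficients; identities in the group algebra are checked on characters. *)
Lemma char_eval_inj0 z : (forall i, char_eval i z = 0) -> z = 0.
Proof.
move=> z0; apply/ffunP => h; rewrite ffunE.
have : \sum_i char_eval i z * ('chi_i h)^* = 0 :> algC.
  by rewrite big1 // => i _; rewrite z0 mul0r.
rewrite /char_eval; under eq_bigr => i _ do rewrite mulr_suml.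
rewrite exchange_big /= (bigD1 h) //= [X in _ + X]big1 => [|g gh].
  rewrite addr0; under eq_bigr => i _ do rewrite -mulrA.
  rewrite -mulr_sumr second_orthogonality_relation ?inE // class_refl mulr1n.
  move/eqP; rewrite mulf_eq0 pnatr_eq0 eqn0Ngt cardG_gt0 orbF => /eqP E.
  by apply: (fmorph_inj (@ratr algC)); apply: etrans E (esym (rmorph0 _)).
under eq_bigr => i _ do rewrite -mulrA.
rewrite -mulr_sumr second_orthogonality_relation ?inE //.
suff -> : (g \in (h ^: [set: G])%g) = false by rewrite mulr0n mulr0.
apply/imsetP => -[k _]; rewrite /conjg => E; move/eqP: gh; apply; rewrite E.
by change (- k + (h + k) = h); rewrite addrCA addNr addr0.
Qed.

Lemma char_eval_inj x y : (forall i, char_eval i x = char_eval i y) -> x = y.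
Proof.
move=> E; apply/eqP; rewrite -subr_eq0; apply/eqP/char_eval_inj0 => i.
by rewrite rmorphB /= E subrr.
Qed.

Lemma char_eval_bar i z : char_eval i (ga_bar z) = (char_eval i z)^*.
Proof.
rewrite /char_eval rmorph_sum (reindex_inj oppr_inj) /=.
apply: eq_bigr => g _; rewrite ffunE opprK rmorphM charN; congr (_ * _).
by rewrite aut_Crat // Crat_rat.
Qed.

(** The coefficients are rational, hence fixed by u: vanishing at a character
    only depends on its Galois orbit. *)
Lemma char_eval_aut (u : {rmorphism algC -> algC}) i z :
  char_eval (aut_Iirr u i) z = u (char_eval i z).
Proof.
rewrite /char_eval rmorph_sum; apply: eq_bigr => g _.
by rewrite aut_IirrE cfunE rmorphM [u (ratr _)]aut_Crat // Crat_rat.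
Qed.

Lemma gal_orbit_refl i : i \in gal_orbit i.
Proof.
rewrite inE; apply/asboolP; exists (idfun : {rmorphism algC -> algC}).
by apply: irr_inj; rewrite aut_IirrE; apply/cfunP => g; rewrite cfunE.
Qed.

Lemma gal_orbit_sub i j : j \in gal_orbit i -> gal_orbit j \subset gal_orbit i.
Proof.
rewrite inE => /asboolP[u ->]; apply/subsetP => k; rewrite !inE => /asboolP[v ->].
apply/asboolP; exists (v \o u : {rmorphism algC -> algC}).
by apply: irr_inj; rewrite !aut_IirrE; apply/cfunP => g; rewrite !cfunE.
Qed.

Lemma gal_orbit_sym i j : j \in gal_orbit i -> i \in gal_orbit j.
Proof.
rewrite !inE => /asboolP[u ->]; apply/asboolP.
exists (algC_invaut u : {rmorphism algC -> algC}).
apply: irr_inj; rewrite !aut_IirrE; apply/cfunP => g.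
by rewrite !cfunE; apply/esym/algC_autK.
Qed.

Lemma gal_orbitP i (o : {set dual}) :
  o \in gal_orbits G -> (i \in o) = (o == gal_orbit i).
Proof.
case/imsetP => j _ ->; apply/idP/eqP => [ij|->]; last exact: gal_orbit_refl.
by apply/eqP; rewrite eqEsubset !gal_orbit_sub // gal_orbit_sym.
Qed.

Lemma gal_orbit_in i : gal_orbit i \in gal_orbits G.
Proof. exact: imset_f. Qed.

Lemma char_eval_orbit i j z :
  j \in gal_orbit i -> (char_eval j z == 0) = (char_eval i z == 0).
Proof. by rewrite inE => /asboolP[u ->]; rewrite char_eval_aut fmorph_eq0. Qed.

(** Orthogonality of rows. *)
Lemma char_eval_idem i (o : {set dual}) :
  o \in gal_orbits G -> char_eval i (idem o) = (i \in o)%:R.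
Proof.
move=> oo; rewrite /char_eval.
under eq_bigr => g _ do rewrite idemE // mulr_suml.
rewrite exchange_big /=.
have E j : \sum_g #|G|%:R^-1 * ('chi_j g)^-1 * 'chi_i g = (i == j)%:R :> algC.
  apply: etrans (first_orthogonality_relation i j).
  rewrite mulr_sumr cardsT; apply: eq_big => g; first by rewrite inE.
  move=> _; rewrite -mulrA; congr (_ * _); rewrite mulrC; congr (_ * _).
  have nz := lin_char_neq0 (char_lin j) (in_setT g).
  by apply: (mulfI nz); rewrite mulfV // -(@charD j g (- g)) subrr char0.
under eq_bigr => j _ do rewrite E.
have [io|io] := boolP (i \in o).
  rewrite (bigD1 i) //= eqxx big1 ?addr0 // => j /andP[_].
  by rewrite eq_sym => /negPf ->.
by rewrite big1 // => j jo; case: eqP => // ij; rewrite ij jo in io.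
Qed.

Lemma in_supp (o : {set dual}) i z :
  o \in gal_orbits G -> i \in o -> (o \in supp z) = (char_eval i z != 0).
Proof.
move=> oo io; rewrite inE oo /=; congr negb; apply/eqP/idP => [E|E].
  move/(congr1 (char_eval i)): E.
  by rewrite rmorphM /= char_eval_idem // io mul1r rmorph0 => ->.
apply: char_eval_inj0 => k; rewrite rmorphM /= char_eval_idem //.
have [ko|] := boolP (k \in o); last by rewrite mul0r.
rewrite mul1r; apply/eqP; rewrite (char_eval_orbit _ (i := i)) //.
by move: io ko; rewrite !(gal_orbitP _ oo) => /eqP <- /eqP {1}->; apply: gal_orbit_refl.
Qed.

Lemma pi_E (S : {set {set dual}}) z : pi_ S z = pi_ S 1 * z.
Proof. by rewrite /pi_ mulr_suml; apply: eq_bigr => o _; rewrite mulr1. Qed.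

Section Cut.
Variable S : {set {set dual}}.
Hypothesis So : S \subset gal_orbits G.

Lemma char_eval_pi1 i : char_eval i (pi_ S 1) = (gal_orbit i \in S)%:R.
Proof.
rewrite rmorph_sum /=.
under eq_bigr => o oS do
  rewrite mulr1 char_eval_idem ?(subsetP So) // gal_orbitP ?(subsetP So) //.
have [iS|iS] := boolP (gal_orbit i \in S).
  by rewrite (bigD1 (gal_orbit i)) //= eqxx big1 ?addr0 // => o /andP[_ /negPf ->].
by rewrite big1 // => o oS; case: eqP => // E; rewrite -E oS in iS.
Qed.

Lemma pi1_idem : pi_ S 1 * pi_ S 1 = pi_ S 1.
Proof.
apply: char_eval_inj => i; rewrite rmorphM /= char_eval_pi1 -natrM mulnb.
by rewrite andbb.
Qed.

Lemma mulr_pi1 z : (forall i, char_eval i z != 0 -> gal_orbit i \in S) ->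
  z * pi_ S 1 = z.
Proof.
move=> zS; apply: char_eval_inj => i; rewrite rmorphM /= char_eval_pi1.
have [->|/zS ->] := eqVneq (char_eval i z) 0; by rewrite ?mul0r ?mulr1.
Qed.
End Cut.

(** The characters separate points, so multiplication by z is injective; it is
    then surjective, the group algebra having finite dimension. *)
Lemma ga_unit z : (forall i, char_eval i z != 0) -> exists w, z * w = 1.
Proof.
move=> z0; pose n := #|G|.
pose gr (v : 'rV[rat]_n) : QG := [ffun g => v 0 (enum_rank g)].
pose M : 'M[rat]_n := \matrix_(a, b) z (enum_val b - enum_val a).
have grM v : gr (v *m M) = z * gr v.
  rewrite mulrC; apply/ffunP => g; rewrite !ffunE mxE.
  rewrite (reindex _ (onW_bij _ (@enum_rank_bij G))) /=.
  by apply: eq_bigr => h _; rewrite !mxE !ffunE !enum_rankK.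
have gr_inj v : gr v = 0 -> v = 0.
  move=> E; apply/rowP => b; rewrite mxE.
  by move/ffunP/(_ (enum_val b)): E; rewrite !ffunE enum_valK.
have Mfree : row_free M.
  apply: inj_row_free => v vM; apply: gr_inj; apply: char_eval_inj0 => i.
  have /(congr1 (char_eval i)) := grM v; rewrite vM rmorphM /=.
  have -> : gr 0 = 0 by apply/ffunP => g; rewrite !ffunE mxE.
  by rewrite rmorph0 => /esym/eqP; rewrite mulf_eq0 (negPf (z0 i)) => /eqP.
pose d : 'rV[rat]_n := \row_b (enum_val b == 0)%:R.
exists (gr (d *m invmx M)); rewrite -grM mulmxKV ?row_free_unit //; last first.
  by rewrite -row_free_unit.
by apply/ffunP => g; rewrite !ffunE mxE enum_rankK.
Qed.

(** Replacing the components of z outside S by 1 gives a unit of the whole group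
    algebra; the image of its inverse in L_S is the inverse sought. *)
Lemma inverse_in_ex (S : {set {set dual}}) z : S \subset gal_orbits G ->
  (forall i, gal_orbit i \in S -> char_eval i z != 0) ->
  exists v, inverse_in S (pi_ S z) v.
Proof.
move=> So zS; set e := pi_ S 1.
have [i|w yw] := @ga_unit (e * z + (1 - e)).
  rewrite rmorphD rmorphB rmorphM rmorph1 /= char_eval_pi1 //.
  have [/zS|_] := boolP (_ \in S); first by rewrite mul1r subrr addr0.
  by rewrite mul0r add0r subr0 oner_neq0.
exists (pi_ S w); split; first by exists w.
have ey : e * (e * z + (1 - e)) = e * z.
  by rewrite mulrDr mulrBr mulr1 mulrA pi1_idem // subrr addr0.
by rewrite (pi_E S w) (pi_E S z) -/e mulrACA pi1_idem // mulrCA mulrC -ey -mulrA yw mulr1.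
Qed.
End Characters.

(** * Dual bases of graded modules *)

(** The elements of each fibre are matched by their ranks in it. *)
Lemma fibre_bij (I J : finType) (T : eqType) (d : I -> T) (d' : J -> T) :
  (forall g, #|[pred k | d k == g]| = #|[pred l | d' l == g]|) ->
  exists s : I -> J, exists2 t : J -> I, cancel s t /\ cancel t s &
    forall k, d' (s k) = d k.
Proof.
move=> E; pose en g := enum [pred k | d k == g].
pose en' g := enum [pred l | d' l == g].
have lt_rank k : (index k (en (d k)) < size (en' (d k)))%N.
  by rewrite -cardE -E cardE index_mem mem_enum /= inE.
have [j0|J0] := pickP J; last first.
  have JF (l : J) : False by have := J0 l.
  have IF (k : I) : False by case: (en' (d k)) (lt_rank k) => // l; case: (JF l).
  by exists (fun k => False_rect J (IF k)), (fun l => False_rect I (JF l));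
    [split=> [k|l]; [case: (IF k) | case: (JF l)] | move=> k; case: (IF k)].
pose s k := nth j0 (en' (d k)) (index k (en (d k))).
have ds k : d' (s k) = d k.
  by have := mem_nth j0 (lt_rank k); rewrite -/(s k) /en' mem_enum inE => /eqP.
have s_inj : injective s.
  move=> k l skl; have dkl : d k = d l by rewrite -!ds skl.
  have /eqP := skl; rewrite /s -dkl nth_uniq ?enum_uniq ?lt_rank //; last first.
    by rewrite dkl lt_rank.
  by move/eqP; apply: (index_inj k); rewrite /en mem_enum inE ?dkl.
have [|t sK tK] := inj_card_bij s_inj.
  have cards (X : finType) (e : X -> T) (S : seq T) :
      (forall x, e x \in S) -> uniq S ->
      #|X| = (\sum_(g <- S) #|[pred x | e x == g]|)%N.
    move=> eS uS; rewrite -sum1_card.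
    under [RHS]eq_bigr => g _ do rewrite -sum1_card big_mkcond.
    rewrite exchange_big /=; apply: eq_bigr => x _.
    rewrite (bigD1_seq (e x)) //= inE eqxx big1 // => g /negPf.
    by rewrite inE eq_sym => ->.
  pose S := undup (codom d ++ codom d').
  rewrite (cards I d S) ?(cards J d' S) ?undup_uniq //.
  - by rewrite leq_eqVlt; apply/orP; left; apply/eqP/eq_bigr => g _; rewrite E.
  - by move=> l; rewrite mem_undup mem_cat codom_f orbT.
  - by move=> k; rewrite mem_undup mem_cat codom_f.
by exists s, t.
Qed.

Section DualBases.
Variables (F : fieldType) (G : finZmodType) (A : galg F G).
Implicit Types (P Q : gmod A) (e : A).

(** The coordinate f_k lowers degrees by d_k, as the coordinate of a shift of A
    does. *)
Record dual_basis P := DualBasis {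
  db_I : finType;
  db_w : db_I -> P;
  db_f : db_I -> P -> A;
  db_d : db_I -> G;
  db_lin : forall k a x y, db_f k (a *: x + y) = a * db_f k x + db_f k y;
  db_wdeg : forall k, mcomp (db_d k) (db_w k);
  db_fdeg : forall k h x, mcomp h x -> gcomp (h - db_d k) (db_f k x);
  db_sum : forall x, \sum_k db_f k x *: db_w k = x }.

Section DualBasis.
Variables (P : gmod A) (b : dual_basis P).
Implicit Types k l : db_I b.

Fact db_linear k : linear (db_f k : P -> A^o).
Proof. exact: db_lin. Qed.

Lemma db_fZ k a x : db_f k (a *: x) = a * db_f k x.
Proof. exact: (linearZ_LR (mk_linear (db_linear k))). Qed.

Lemma db_f0 k : db_f k 0 = 0.
Proof. exact: (linear0 (mk_linear (db_linear k))). Qed.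

Lemma db_f_sum (I : Type) (r : seq I) (Pr : pred I) (u : I -> P) k :
  db_f k (\sum_(i <- r | Pr i) u i) = \sum_(i <- r | Pr i) db_f k (u i).
Proof. exact: (linear_sum (mk_linear (db_linear k))). Qed.
End DualBasis.

(** For e idempotent of degree 0, this presents P as a direct sum of shifts of
    the left ideal A e, with generators [db_w k] of degrees [db_d k]. *)
Definition frame e P (b : dual_basis P) : Prop :=
  (forall k l : db_I b, db_f l (db_w k) = if k == l then e else 0) /\
  (forall (k : db_I b) x, db_f k x * e = db_f k x).

Definition db_count P (b : dual_basis P) g := #|[pred k | db_d (d := b) k == g]|.

Definition db_match P Q (b : dual_basis P) (c : dual_basis Q)
    (s : db_I b -> db_I c) (x : P) : Q :=
  \sum_k db_f k x *: db_w (s k).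

Lemma db_match_linear P Q (b : dual_basis P) (c : dual_basis Q)
  (s : db_I b -> db_I c) : linear (db_match s).
Proof.
move=> a x y; rewrite /db_match scaler_sumr -big_split.
by apply: eq_bigr => k _; rewrite db_lin scalerDl scalerA.
Qed.

Lemma db_match_graded P Q (b : dual_basis P) (c : dual_basis Q)
  (s : db_I b -> db_I c) : (forall k, db_d (s k) = db_d k) ->
  graded_hom (db_match s).
Proof.
move=> ds h x hx; apply: (grading_sum (mcomp_grading Q)) => k _.
by rewrite -[h](subrK (db_d k)); apply: mcompZ; [apply: db_fdeg | rewrite -ds; apply: db_wdeg].
Qed.

Lemma db_matchK P Q (b : dual_basis P) (c : dual_basis Q)
  (s : db_I b -> db_I c) (t : db_I c -> db_I b) e :
  frame e b -> frame e c -> cancel s t -> cancel t s ->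
  cancel (db_match s) (db_match t).
Proof.
move=> [fb1 fb2] [fc1 fc2] sK tK x; rewrite -[RHS](db_sum b).
rewrite /db_match (reindex s) /=; last by exists t => ? _.
apply: eq_bigr => k _; rewrite sK; congr (_ *: _).
rewrite db_f_sum (bigD1 k) //= db_fZ fc1 eqxx fb2 big1 ?addr0 // => l lk.
by rewrite db_fZ fc1 (can_eq sK) (negPf lk) mulr0.
Qed.

Lemma frame_iso P Q (b : dual_basis P) (c : dual_basis Q) e :
  frame e b -> frame e c -> db_count b =1 db_count c -> gmod_iso P Q.
Proof.
move=> fb fc /fibre_bij[s [t [sK tK] ds]].
apply: (@gmod_isoI _ _ _ _ _ (db_match s) (db_match t)).
- exact: db_match_linear.
- exact: db_match_graded.
- by apply: db_match_graded => l; rewrite -ds tK.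
- exact: db_matchK fb fc sK tK.
- exact: db_matchK fc fb tK sK.
Qed.

Section Constructions.
Variables P Q : gmod A.

Lemma frame_transport (b : dual_basis P) e : frame e b -> gmod_iso P Q ->
  exists2 c : dual_basis Q, frame e c & db_count c =1 db_count b.
Proof.
move=> [fb1 fb2] [f [h [gf gh fK hK]]].
have lin k a x y : db_f (d := b) k (h (a *: x + y)) = a * db_f k (h x) + db_f k (h y).
  by rewrite linearP db_lin.
have wdeg k : mcomp (db_d (d := b) k) (f (db_w k)) by apply/gf/db_wdeg.
have fdeg k g x : mcomp g x -> gcomp (g - db_d (d := b) k) (db_f k (h x)).
  by move/gh; apply: db_fdeg.
have sum x : \sum_k db_f k (h x) *: f (db_w (d := b) k) = x.
  rewrite -[RHS]hK -[h x in RHS](db_sum b) linear_sum.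
  by apply: eq_bigr => k _; rewrite linearZ.
exists (DualBasis lin wdeg fdeg sum) => //; split=> [k l|k x] /=; last exact: fb2.
by rewrite fK fb1.
Qed.

Lemma frame_shift (b : dual_basis P) e g : frame e b ->
  exists2 c : dual_basis (gshift g P), frame e c &
    forall h, db_count c h = db_count b (h - g).
Proof.
move=> [fb1 fb2].
have wdeg k : mcomp (db_d (d := b) k + g) (db_w k : gshift g P).
  by rewrite /= /shift_comp addrK; apply: db_wdeg.
have fdeg k h (x : gshift g P) : mcomp h x ->
    gcomp (h - (db_d (d := b) k + g)) (db_f k x).
  by move=> hx; rewrite opprD addrCA addrC; apply: db_fdeg.
have sum (x : gshift g P) : \sum_k db_f (d := b) k x *: db_w k = x := db_sum b x.
exists (@DualBasis (gshift g P) _ _ _ _ (@db_lin _ b) wdeg fdeg sum) => // h.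
by apply: eq_card => k; rewrite !inE /= eq_sym -subr_eq eq_sym.
Qed.

Lemma frame_sum (b : dual_basis P) (c : dual_basis Q) e : frame e b -> frame e c ->
  exists2 d : dual_basis (gsum P Q), frame e d &
    forall h, db_count d h = (db_count b h + db_count c h)%N.
Proof.
move=> [fb1 fb2] [fc1 fc2].
pose I := (db_I b + db_I c)%type.
pose w (k : I) : gsum P Q :=
  match k with inl i => (db_w i, 0) | inr j => (0, db_w j) end.
pose f (k : I) (x : gsum P Q) :=
  match k with inl i => db_f i x.1 | inr j => db_f j x.2 end.
pose d (k : I) := match k with inl i => db_d i | inr j => db_d j end.
have lin k a x y : f k (a *: x + y) = a * f k x + f k y.
  by case: k => k; apply: db_lin.
have wdeg k : mcomp (d k) (w k).
  by case: k => k; split=> /=; try exact: db_wdeg; apply: (grading0 (mcomp_grading _)).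
have fdeg k h x : mcomp h x -> gcomp (h - d k) (f k x).
  by case: k => k [? ?]; apply: db_fdeg.
have sum x : \sum_k f k x *: w k = x.
  rewrite big_sumType /= [LHS]surjective_pairing [RHS]surjective_pairing.
  rewrite !raddfD !(raddf_sum fst) !(raddf_sum snd) /=; congr pair.
    by rewrite -[RHS](db_sum b) [X in _ + X]big1 ?addr0 // => k _; apply: scaler0.
  by rewrite -[RHS](db_sum c) [X in X + _]big1 ?add0r // => k _; apply: scaler0.
exists (DualBasis lin wdeg fdeg sum) => [|h].
  split=> [[k|k] [l|l]|[k|k] x] //=; rewrite ?db_f0 ?fb1 ?fc1 //.
by rewrite /db_count -!sum1_card big_mkcond big_sumType /= -!big_mkcond.
Qed.
End Constructions.

(** A homogeneous Murray-von Neumann equivalence between e and a sum of copies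
    of e': it makes A e a direct sum of shifts of A e'. *)
Record splitting (e e' : A) := Splitting {
  sp_B : finType;
  sp_f : sp_B -> A;
  sp_g : sp_B -> A;
  sp_c : sp_B -> G;
  sp_sum : \sum_q sp_g q * sp_f q = e;
  sp_orth : forall q r, sp_f q * sp_g r = if q == r then e' else 0;
  sp_ge : forall q, sp_g q * e' = sp_g q;
  sp_fdeg : forall q, gcomp (sp_c q) (sp_f q);
  sp_gdeg : forall q, gcomp (- sp_c q) (sp_g q) }.

Section Refinement.
Variables (P : gmod A) (b : dual_basis P) (e e' : A) (s : splitting e e').
Hypothesis fe : forall (k : db_I b) x, db_f k x * e = db_f k x.

Let I := (db_I b * sp_B s)%type.
Let w (k : I) := sp_f k.2 *: db_w k.1.
Let f (k : I) x := db_f k.1 x * sp_g k.2.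
Let d (k : I) := sp_c k.2 + db_d k.1.

Fact refine_lin k a x y : f k (a *: x + y) = a * f k x + f k y.
Proof. by rewrite /f db_lin mulrDl mulrA. Qed.

Fact refine_wdeg k : mcomp (d k) (w k).
Proof. by apply: mcompZ; [apply: sp_fdeg | apply: db_wdeg]. Qed.

Fact refine_fdeg k h x : mcomp h x -> gcomp (h - d k) (f k x).
Proof.
move=> hx; rewrite /d opprD addrCA addrC.
by apply: gcompM; [apply: db_fdeg | apply: sp_gdeg].
Qed.

Fact refine_sum x : \sum_k f k x *: w k = x.
Proof.
rewrite -[RHS](db_sum b).
rewrite -(pair_bigA _ (fun k q => f (k, q) x *: w (k, q))) /=; apply: eq_bigr => k _.
have E : db_f k x * (\sum_q sp_g q * sp_f (s := s) q) = db_f k x.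
  by rewrite sp_sum fe.
rewrite -[in RHS]E mulr_sumr scaler_suml.
by apply: eq_bigr => q _; rewrite /f /w scalerA /= mulrA.
Qed.

Definition db_refine := DualBasis refine_lin refine_wdeg refine_fdeg refine_sum.

Lemma refine_fe (k : db_I db_refine) x : db_f k x * e' = db_f k x.
Proof. by rewrite /= /f -mulrA sp_ge. Qed.

Lemma splitting_fe (q : sp_B s) : sp_f q * e = e' * sp_f q.
Proof.
have -> : sp_f q * e = sp_f q * (\sum_r sp_g r * sp_f (s := s) r).
  by rewrite sp_sum.
rewrite mulr_sumr (bigD1 q) //= mulrA sp_orth eqxx big1 ?addr0 //.
by move=> r rq; rewrite mulrA sp_orth eq_sym (negPf rq) mul0r.
Qed.
End Refinement.

Lemma frame_refine P (b : dual_basis P) e e' (s : splitting e e')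
    (fb : frame e b) : e' * e' = e' -> frame e' (db_refine s fb.2).
Proof.
case: (fb) => fb1 fb2 e'e'; split=> [[k q] [l r]|k x]; last exact: refine_fe.
rewrite /= db_fZ fb1 xpair_eqE /=; case: (k == l) => /=; last by rewrite mulr0 mul0r.
by rewrite splitting_fe -mulrA sp_orth; case: (q == r); rewrite ?mulr0.
Qed.
End DualBases.

(** * Modules with dual bases *)

Section Corner.
Variables (F : fieldType) (G : finZmodType) (A : galg F G) (e : A).

Definition left_ideal_pred : {pred A^o} := fun x => (x : A) * e == x.

Fact left_ideal_closed : submod_closed left_ideal_pred.
Proof.
split=> [|a x y]; rewrite !unfold_in; first by rewrite mul0r.
by move=> /eqP xe /eqP ye; rewrite mulrDl ye -mulrA xe.
Qed.
HB.instance Definition _ := GRing.isSubmodClosed.Build A A^o left_ideal_pred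
  left_ideal_closed.

Record left_ideal := LeftIdeal {
  left_ideal_val : A^o; _ : left_ideal_val \in left_ideal_pred }.
HB.instance Definition _ := [isSub for left_ideal_val].
HB.instance Definition _ := [Choice of left_ideal by <:].
HB.instance Definition _ := [SubChoice_isSubLmodule of left_ideal by <:].

Local Notation v x := (left_ideal_val x : galg_sort A).

Lemma left_idealP (x : left_ideal) : v x * e = v x.
Proof. exact/eqP/(valP x). Qed.

Hypotheses (ee : e * e = e) (e0 : gcomp 0 e).

Fact mem_left_ideal (x : A) : x * e \in left_ideal_pred.
Proof. by rewrite unfold_in /left_ideal_pred -mulrA ee. Qed.

Definition to_left_ideal (x : A) : left_ideal := LeftIdeal (mem_left_ideal x).

Fact left_ideal_grading : is_grading (fun g (x : left_ideal) => gcomp g (v x)).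
Proof.
have gA := gcomp_grading A; apply: is_gradingP.
- by move=> g; apply: (grading0 gA).
- by move=> g x y; apply: (gradingB gA).
- move=> x; have [d [cd dx]] := grading_ex gA (v x).
  exists [ffun g => to_left_ideal (d g)]; split=> [g|].
    by rewrite ffunE /=; have := gcompM (cd g) e0; rewrite addr0.
  apply: val_inj; rewrite (raddf_sum (\val : left_ideal -> A^o)) /=.
  rewrite -[RHS]left_idealP -dx mulr_suml.
  by apply: eq_bigr => g _; rewrite ffunE.
- move=> d cd d0 g; apply: val_inj.
  have := grading_eq0 gA (d := [ffun g => v (d g)]) _ _ g.
  rewrite ffunE; apply=> [h|]; first by rewrite ffunE.
  have /(congr1 (\val : left_ideal -> A^o)) := d0.
  rewrite raddf_sum /= => E; apply: etrans E.
  by apply: eq_bigr => h _; rewrite ffunE.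
Qed.

Fact left_ideal_gscale g h (a : A) (x : left_ideal) :
  gcomp g a -> gcomp h (v x) -> gcomp (g + h) (v (a *: x)).
Proof. exact: gcompM. Qed.

Definition left_ideal_gmod : gmod A := GMod left_ideal_grading left_ideal_gscale.

Let gen : left_ideal_gmod := to_left_ideal e.

Fact left_ideal_gen (x : left_ideal_gmod) : x = v x *: gen.
Proof. by apply: val_inj; rewrite /= ee; apply/esym/left_idealP. Qed.

Fact left_ideal_fg : fin_gen left_ideal_gmod.
Proof.
exists 1%N, (fun=> gen) => x; exists (fun=> v x).
by rewrite big_ord1; apply: left_ideal_gen.
Qed.

(** A graded map out of A e is determined by the image of e, which lifts to a
    homogeneous element of degree 0: take the component of degree 0 of any lift. *)
Fact left_ideal_proj : gprojective left_ideal_gmod.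
Proof.
move=> M N p f gp sp gf; have [m pm] := sp (f gen).
have [gM gN] := (mcomp_grading M, mcomp_grading N).
have ge : mcomp 0 gen by rewrite /= ee.
have [d [cd dm]] := grading_ex gM m.
have pd : p (d 0) = f gen.
  have := @grading_uniq _ _ _ gN [ffun g => p (d g)]
    [ffun g => if g == 0 then f gen else 0].
  move=> /(_ _ _ _)/ffunP/(_ 0); rewrite !ffunE eqxx => -> //.
  - by move=> g; rewrite ffunE; apply: gp.
  - move=> g; rewrite ffunE; case: eqP => [->|_]; last exact: (grading0 gN).
    exact/gf.
  under eq_bigr do rewrite ffunE.
  rewrite -linear_sum dm pm (bigD1 0) //= ffunE eqxx big1 ?addr0 // => g g0.
  by rewrite ffunE (negPf g0).
have lh : linear (fun a : left_ideal_gmod => v a *: d 0).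
  by move=> a x y; rewrite scalerDl scalerA.
exists (mk_linear lh) => [g x cx|x /=].
  by rewrite -[g]addr0; apply: mcompZ.
by rewrite linearZ /= pd -linearZ /=; congr (f _); rewrite -left_ideal_gen.
Qed.

Definition left_ideal_fgp : fgp A := FGP left_ideal_fg left_ideal_proj.

Lemma left_ideal_frame : exists2 b : dual_basis left_ideal_gmod, frame e b &
  forall g, db_count b g = (g == 0).
Proof.
have lin (k : unit) a (x y : left_ideal_gmod) :
  v (a *: x + y : left_ideal) = a * v x + v y by [].
have wdeg (k : unit) : mcomp 0 gen by rewrite /= ee.
have fdeg (k : unit) h (x : left_ideal_gmod) :
    mcomp h x -> gcomp (h - 0) (v x) by rewrite subr0.
have sum (x : left_ideal_gmod) : \sum_(k : unit) v x *: gen = x.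
  by rewrite big_const card_unit /= addr0 -left_ideal_gen.
exists (DualBasis lin wdeg fdeg sum) => [|g].
  by split=> [[] []|k x] /=; [apply: ee | apply: left_idealP].
rewrite /db_count; have [g0|g0] := eqVneq g 0.
  by rewrite (eq_card (B := predT)) ?card_unit // => -[]; rewrite !inE eqxx.
by apply: eq_card0 => k; rewrite !inE.
Qed.
End Corner.

Section FreeModule.
Variables (F : fieldType) (G : finZmodType) (A : galg F G).
Variables (I : finType) (d : I -> G).

Definition free_comp (h : G) (x : {ffun I -> A^o}) : Prop :=
  forall k, gcomp (h - d k) (x k : A).

Fact free_grading : is_grading free_comp.
Proof.
have gA := gcomp_grading A; apply: is_gradingP.
- by move=> g k; rewrite ffunE; apply: (grading0 gA).
- by move=> g x y cx cy k; rewrite !ffunE; apply: (gradingB gA).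
- move=> x.
  have /choice[c cP] : forall k, exists c : {ffun G -> A},
      (forall g, gcomp g (c g)) /\ \sum_g c g = x k by move=> k; apply: grading_ex.
  exists [ffun h => [ffun k => c k (h - d k)]]; split=> [h k|].
    by rewrite !ffunE; case: (cP k).
  apply/ffunP => k; rewrite sum_ffunE; have [_ <-] := cP k.
  rewrite [RHS](reindex_inj (addIr (- d k))) /=.
  by apply: eq_bigr => h _; rewrite !ffunE.
- move=> c cc c0 g; apply/ffunP => k; rewrite ffunE.
  have := grading_eq0 gA (d := [ffun h => c (h + d k) k]) _ _ (g - d k).
  rewrite ffunE subrK; apply=> [h|].
    by rewrite ffunE; have := cc (h + d k) k; rewrite addrK.
  move/ffunP/(_ k): c0; rewrite sum_ffunE ffunE => E; apply: etrans E.
  by rewrite [RHS](reindex_inj (addIr (d k))) /=; apply: eq_bigr => h _; rewrite ffunE.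
Qed.

Fact freeZ g h (a : A) (x : {ffun I -> A^o}) :
  gcomp g a -> free_comp h x -> free_comp (g + h) (a *: x).
Proof. by move=> ca cx k; rewrite ffunE -addrA; apply: gcompM. Qed.

Definition gfree : gmod A := GMod free_grading freeZ.
End FreeModule.

Section FgProjective.
Variables (F : fieldType) (G : finZmodType) (A : galg F G) (P : gmod A).

Lemma homogeneous_gens : fin_gen P ->
  exists (I : finType) (w : I -> P) (d : I -> G),
    (forall k, mcomp (d k) (w k)) /\ forall x, exists c : I -> A, x = \sum_k c k *: w k.
Proof.
case=> n [e eP].
have /choice[c cP] : forall i, exists c : {ffun G -> P},
    (forall g, mcomp g (c g)) /\ \sum_g c g = e i by move=> i; apply/grading_ex/mcomp_grading.
exists ('I_n * G)%type, (fun k => c k.1 k.2), snd; split=> [k|x].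
  by case: (cP k.1).
have [a ->] := eP x; exists (fun k => a k.1).
rewrite -(pair_bigA _ (fun i g => a i *: c i g)) /=; apply: eq_bigr => i _.
by have [_ <-] := cP i; rewrite scaler_sumr.
Qed.

(** The graded version of the dual basis lemma: split the surjection of a
    graded free module onto P given by homogeneous generators. *)
Lemma dual_basis_ex : fin_gen P -> gprojective P -> inhabited (dual_basis P).
Proof.
move=> /homogeneous_gens[I [w [d [wd wP]]]] pP.
pose p (c : gfree A d) : P := \sum_k ((c : {ffun I -> A^o}) k : A) *: w k.
have lp : linear p.
  move=> a x y; rewrite /p scaler_sumr -big_split; apply: eq_bigr => k _.
  by rewrite !ffunE scalerDl scalerA.
have gp : graded_hom (mk_linear lp).
  move=> g x cx; apply: (grading_sum (mcomp_grading P)) => k _.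
  by rewrite -[g](subrK (d k)); apply: mcompZ; [apply: cx | apply: wd].
have sp y : exists x, mk_linear lp x = y.
  have [c ->] := wP y; exists [ffun k => (c k : A^o)].
  by apply: eq_bigr => k _; rewrite ffunE.
have gid : graded_hom (idfun : {linear P -> P}) by [].
have [h gh ph] := pP _ _ _ _ gp sp gid.
have lin k a x y : (h (a *: x + y) : {ffun I -> A^o}) k =
    a * (h x : {ffun I -> A^o}) k + (h y : {ffun I -> A^o}) k :> A.
  by rewrite linearP !ffunE.
have fdeg k g x : mcomp g x -> gcomp (g - d k) ((h x : {ffun I -> A^o}) k : A).
  by move=> /gh; apply.
by constructor; apply: (DualBasis lin wd fdeg (ph : forall x, _ = x)).
Qed.
End FgProjective.

(** * From scalar Gram matrices to frames *)

Section LinearAlgebra.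
Variables (K : fieldType) (T : eqType).

(** A full-rank family D of rows of c is homogeneous because c is; a left factor
    C with C D = c can then be made homogeneous by deleting its entries in wrong
    degrees, and D C D = D c = D gives D C = 1. *)
Lemma homogeneous_idempotent_factor (I : finType) (c : I -> I -> K) (d : I -> T) :
  (forall k l, \sum_m c k m * c m l = c k l) ->
  (forall k l, c k l != 0 -> d k = d l) ->
  exists (r : nat) (C : I -> 'I_r -> K) (D : 'I_r -> I -> K) (u : 'I_r -> T),
    [/\ forall k l, \sum_s C k s * D s l = c k l,
        forall s t, \sum_k D s k * C k t = (s == t)%:R,
        forall k s, C k s != 0 -> u s = d k
      & forall s k, D s k != 0 -> u s = d k].
Proof.
move=> cc cd; pose M : 'M[K]_#|I| := \matrix_(a, b) c (enum_val a) (enum_val b).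
have sumI (f : I -> K) : \sum_k f k = \sum_(a < #|I|) f (enum_val a).
  by rewrite (reindex _ (onW_bij _ (@enum_val_bij I))).
have MM : M *m M = M.
  by apply/matrixP => a b; rewrite !mxE -cc sumI; apply: eq_bigr => q _; rewrite !mxE.
pose f := maxrankfun M; pose D := rowsub f M.
have Dfree : row_free D by apply: maxrowsub_free.
have [C0 C0D] : exists C0, M = C0 *m D by apply/submxP; rewrite eq_maxrowsub.
pose u s := d (enum_val (f s)).
have Du s b : D s b != 0 -> u s = d (enum_val b).
  by rewrite !mxE => /cd.
pose C : 'M[K]_(#|I|, \rank M) :=
  \matrix_(a, s) if u s == d (enum_val a) then C0 a s else 0.
have CD : C *m D = M.
  apply/matrixP => a b; rewrite mxE.
  have [dab|dab] := eqVneq (d (enum_val a)) (d (enum_val b)).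
    have /matrixP/(_ a b) -> := C0D; rewrite mxE.
    apply: eq_bigr => s _; rewrite mxE; case: eqP => // us.
    have [->|/Du E] := eqVneq (D s b) 0; first by rewrite !mulr0.
    by case: us; rewrite dab.
  transitivity (0 : K).
    apply: big1 => s _; rewrite mxE; case: eqP => [us|_]; last by rewrite mul0r.
    have [->|/Du E] := eqVneq (D s b) 0; first by rewrite mulr0.
    by case/eqP: dab; rewrite -us.
  by apply/esym/eqP; apply: contraNT dab; rewrite mxE => /cd ->.
have DM : D *m M = D by rewrite /D mul_rowsub_mx MM.
have DC : D *m C = 1%:M.
  by apply: (row_free_inj Dfree); rewrite -mulmxA CD DM mul1mx.
exists (\rank M), (fun k s => C (enum_rank k) s), (fun s k => D s (enum_rank k)), u.
split=> [k l|s t|k s|s k].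
- have /matrixP/(_ (enum_rank k) (enum_rank l)) := CD.
  by rewrite !mxE !enum_rankK.
- have /matrixP/(_ s t) := DC; rewrite !mxE => <-.
  by rewrite sumI; apply: eq_bigr => a _; rewrite enum_valK.
- by rewrite mxE enum_rankK; case: ifP => [/eqP //|_]; rewrite eqxx.
- by move/Du; rewrite enum_rankK.
Qed.

(** Restricted to the indices of label g, X still has a right inverse. *)
Lemma homogeneous_count_le (I J : finType) (d : I -> T) (d' : J -> T)
    (X : I -> J -> K) (Y : J -> I -> K) :
  (forall k k', \sum_l X k l * Y l k' = (k == k')%:R) ->
  (forall k l, X k l != 0 -> d k = d' l) ->
  forall g, (#|[pred k | d k == g]| <= #|[pred l | d' l == g]|)%N.
Proof.
move=> XY Xd g; set Ig := [pred k | d k == g]; set Jg := [pred l | d' l == g].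
pose X' : 'M[K]_(#|Ig|, #|Jg|) := \matrix_(a, b) X (enum_val a) (enum_val b).
pose Y' : 'M[K]_(#|Jg|, #|Ig|) := \matrix_(b, a) Y (enum_val b) (enum_val a).
apply: (@mulmx1_min _ _ _ X' Y'); apply/matrixP => a a'; rewrite !mxE.
rewrite -(inj_eq enum_val_inj) -XY (bigID (mem Jg)) /= [X in _ + X]big1 ?addr0.
  by rewrite [RHS]big_enum_val; apply: eq_bigr => b _; rewrite !mxE.
move=> l; rewrite !inE => lg; suff -> : X (enum_val a) l = 0 by rewrite mul0r.
apply/eqP; apply: contraNT lg => /Xd <-.
by have := enum_valP a; rewrite inE.
Qed.
End LinearAlgebra.

Section ScalarGram.
Variables (F : fieldType) (G : finZmodType) (A : galg F G).
Implicit Types (P : gmod A) (e : A).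

Lemma grading_disjoint (V : zmodType) (c : G -> V -> Prop) : is_grading c ->
  forall g h x, c g x -> c h x -> x != 0 -> g = h.
Proof.
move=> gr g h x cg ch; apply: contraNeq => gh; apply/eqP.
have := @grading_uniq _ _ _ gr [ffun k => if k == g then x else 0]
  [ffun k => if k == h then x else 0].
move=> /(_ _ _ _)/ffunP/(_ g); rewrite !ffunE eqxx (negPf gh) => -> //.
- by move=> k; rewrite ffunE; case: eqP => [->|_] //; apply: (grading0 gr).
- by move=> k; rewrite ffunE; case: eqP => [->|_] //; apply: (grading0 gr).
have sum1 l : \sum_k [ffun k => if k == l then x else 0 : V] k = x.
  by rewrite (bigD1 l) //= ffunE eqxx big1 ?addr0 // => k /negPf; rewrite ffunE => ->.
by rewrite !sum1.
Qed.

Lemma scalar_degree e g h (c : F) : gcomp 0 e -> e != 0 ->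
  gcomp (g - h) (c *: e) -> c != 0 -> g = h.
Proof.
move=> e0 ne0 ce c0; apply/eqP; rewrite -subr_eq0; apply/eqP.
apply: (grading_disjoint (gcomp_grading A) ce (gcompZ c e0)).
by rewrite scaler_eq0 negb_or c0.
Qed.

Lemma scaler_injl e : e != 0 -> injective (fun c : F => c *: e).
Proof.
move=> ne0 c d /= /eqP; rewrite -subr_eq0 -scalerBl scaler_eq0 (negPf ne0) orbF.
by rewrite subr_eq0 => /eqP.
Qed.

Section Frame.
Variables (P : gmod A) (e : A).
Hypotheses (ee : e * e = e) (e0 : gcomp 0 e) (ne0 : e != 0).

Lemma gram_degree (b : dual_basis P) (k : db_I b) g (y : P) c :
  mcomp g y -> db_f k y = c *: e -> c != 0 -> g = db_d k.
Proof.
by move=> gy E; apply: (scalar_degree e0 ne0); rewrite -E; apply: db_fdeg.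
Qed.

(** A scalar Gram matrix c is idempotent, and f and w transform by the two
    factors of a homogeneous rank factorization of c. *)
Lemma frame_of_gram (b : dual_basis P) (c : db_I b -> db_I b -> F) :
  (forall (k : db_I b) x, db_f k x * e = db_f k x) ->
  (forall k l, db_f l (db_w k) = c k l *: e) -> exists b' : dual_basis P, frame e b'.
Proof.
move=> fe gram.
have cc k l : \sum_m c k m * c m l = c k l.
  apply: (scaler_injl ne0); rewrite -gram -[db_w k](db_sum b) db_f_sum scaler_suml.
  apply: eq_bigr => m _.
  by rewrite db_fZ !gram -scalerAl -scalerAr ee scalerA.
have cd k l : c k l != 0 -> db_d k = db_d l.
  exact: gram_degree (db_wdeg k) (gram k l).
have [r [C [D [u [CD DC Cu Du]]]]] := homogeneous_idempotent_factor cc cd.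
pose w (s : 'I_r) : P := \sum_k (D s k)%:A *: db_w k.
pose f (s : 'I_r) x : A := \sum_k C k s *: db_f k x.
have lin s a x y : f s (a *: x + y) = a * f s x + f s y.
  rewrite /f mulr_sumr -big_split; apply: eq_bigr => k _.
  by rewrite db_lin scalerDr scalerAr.
have wdeg s : mcomp (u s) (w s).
  apply: (grading_sum (mcomp_grading P)) => k _.
  have [->|/Du ->] := eqVneq (D s k) 0.
    by rewrite !scale0r; apply: (grading0 (mcomp_grading P)).
  by rewrite -[db_d k]add0r; apply: mcompZ (db_wdeg k); apply/gcompZ/gcomp1.
have fdeg s h x : mcomp h x -> gcomp (h - u s) (f s x).
  move=> hx; apply: (grading_sum (gcomp_grading A)) => k _.
  have [->|/Cu ->] := eqVneq (C k s) 0.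
    by rewrite scale0r; apply: (grading0 (gcomp_grading A)).
  exact/gcompZ/db_fdeg.
have sum x : \sum_s f s x *: w s = x.
  rewrite -[RHS](db_sum b).
  transitivity (\sum_k \sum_l (c k l *: db_f k x) *: db_w l).
    transitivity (\sum_s \sum_k \sum_l ((C k s * D s l) *: db_f k x) *: db_w l).
      apply: eq_bigr => s _; rewrite scaler_suml; apply: eq_bigr => k _.
      rewrite scaler_sumr; apply: eq_bigr => l _.
      by rewrite scalerA -scalerAl -scalerAr mulr1 scalerA.
    rewrite exchange_big; apply: eq_bigr => k _ /=.
    rewrite exchange_big; apply: eq_bigr => l _ /=.
    by rewrite -scaler_suml -scaler_suml CD.
  apply: eq_bigr => k _; rewrite -[db_w k in RHS](db_sum b) scaler_sumr.
  by apply: eq_bigr => l _; rewrite gram scalerA -scalerAr fe.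
exists (DualBasis lin wdeg fdeg sum); split=> [s t|s x] /=.
  have -> : f t (w s) = (\sum_k \sum_l C l t * (D s k * c k l)) *: e.
    rewrite /f exchange_big scaler_suml; apply: eq_bigr => l _ /=.
    rewrite db_f_sum scaler_sumr scaler_suml; apply: eq_bigr => k _.
    by rewrite db_fZ gram -scalerAl mul1r !scalerA mulrA.
  transitivity ((s == t)%:R *: e); last by case: eqP; rewrite ?scale1r ?scale0r.
  congr (_ *: _); rewrite -DC exchange_big; apply: eq_bigr => l _ /=.
  rewrite -mulr_sumr mulrC; congr (_ * _).
  under eq_bigr => k _ do rewrite -CD mulr_sumr.
  rewrite exchange_big /= (bigD1 s) //= [X in _ + X]big1 ?addr0.
    under eq_bigr => k _ do rewrite mulrA.
    by rewrite -mulr_suml DC eqxx mul1r.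
  move=> q qs; under eq_bigr => k _ do rewrite mulrA.
  by rewrite -mulr_suml DC eq_sym (negPf qs) mul0r.
by rewrite /f mulr_suml; apply: eq_bigr => k _; rewrite -scalerAl fe.
Qed.

(** The product of the two transition matrices is the Gram matrix of b. *)
Lemma frame_count_le (b c : dual_basis P) X Y : frame e b -> frame e c ->
  (forall (k : db_I b) (l : db_I c), db_f l (db_w k) = X k l *: e) ->
  (forall (k : db_I b) (l : db_I c), db_f k (db_w l) = Y l k *: e) ->
  forall g, (db_count b g <= db_count c g)%N.
Proof.
move=> [fb _] _ EX EY; apply: (@homogeneous_count_le F _ _ _ _ _ X Y); last first.
  by move=> k l; apply: gram_degree (db_wdeg k) (EX k l).
move=> k k'; apply: (scaler_injl ne0).
transitivity (db_f k' (db_w k)); last by rewrite fb; case: eqP; rewrite ?scale1r ?scale0r.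
rewrite -[db_w k](db_sum c) db_f_sum scaler_suml; apply: eq_bigr => l _.
by rewrite db_fZ EX EY -scalerAl -scalerAr ee scalerA.
Qed.

Lemma frame_count_eq (b c : dual_basis P) X Y : frame e b -> frame e c ->
  (forall (k : db_I b) (l : db_I c), db_f l (db_w k) = X k l *: e) ->
  (forall (k : db_I b) (l : db_I c), db_f k (db_w l) = Y l k *: e) ->
  db_count b =1 db_count c.
Proof.
move=> fb fc EX EY g; apply/eqP; rewrite eqn_leq.
by rewrite (frame_count_le fb fc EX EY) (frame_count_le fc fb (X := Y) (Y := X)).
Qed.
End Frame.
End ScalarGram.

(** * Graded direct limits along injective maps *)

Section Limit.
Variables (F : fieldType) (G : finZmodType) (R : nat -> galg F G).
Variable f : forall i, {lrmorphism R i -> R i.+1}.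
Hypothesis fgr : forall i g x, gcomp g x -> gcomp g (f i x).
Hypothesis finj : forall i, injective (f i).
Local Notation A := (dlim_galg fgr).

Definition lim_in i (z : R i) : A := dlim_in f z.

(** Stated for an arbitrary binary operation that commutes with the transition
    maps; the induction starts at an index k equal, but not convertible, to i. *)
Lemma tfrom_map (i : nat) (op : forall k, R k -> R k -> R k) (z w : R i) k :
  (forall k (x y : R k), op k.+1 (f k x) (f k y) = f k (op k x y)) ->
  (i <= k)%N -> tfrom f (op i z w) k = op k (tfrom f z k) (tfrom f w k).
Proof.
move=> opf; elim: k => [|k IHk].
  by rewrite leqn0 => /eqP i0; move: z w; rewrite i0 => z w; rewrite !tfrom_id.
rewrite leq_eqVlt => /predU1P[ik|ik].
  by move: z w {IHk}; rewrite ik => z w; rewrite !tfrom_id.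
by rewrite !tfromS // IHk // opf.
Qed.

Lemma lim_inD i : {morph @lim_in i : z w / z + w}.
Proof.
move=> z w; apply: esym; apply: etrans (daddE _ _) _; apply/dclsP; exists i => k ik /=.
by rewrite (tfrom_map (op := fun k => +%R)) // => l x y; rewrite rmorphD.
Qed.

Lemma lim_inM i : {morph @lim_in i : z w / z * w}.
Proof.
move=> z w; apply: esym; apply: etrans (dmulE _ _) _; apply/dclsP; exists i => k ik /=.
by rewrite (tfrom_map (op := fun k => *%R)) // => l x y; rewrite rmorphM.
Qed.

Lemma lim_inZ i c : {morph @lim_in i : z / c *: z}.
Proof.
move=> z; apply: esym; apply: etrans (dscaleE _ _) _; apply/dclsP; exists i => k ik /=.
by rewrite (tfrom_map (op := fun k x _ => c *: x)) // => l x _; rewrite linearZ.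
Qed.

Lemma lim_in1 i : @lim_in i 1 = 1.
Proof.
apply/dclsP; exists i => k ik /=.
rewrite (tfrom_map (op := fun k _ _ => 1) 0 0) // => l x y; exact/esym/rmorph1.
Qed.

Lemma lim_in0 i : @lim_in i 0 = 0.
Proof. by apply: (@addrI A (@lim_in i 0)); rewrite -lim_inD !addr0. Qed.

Lemma lim_in_sum i (I : Type) (r : seq I) (Pr : pred I) (z : I -> R i) :
  lim_in (\sum_(k <- r | Pr k) z k) = \sum_(k <- r | Pr k) lim_in (z k).
Proof. exact: (big_morph _ (@lim_inD i) (lim_in0 i)). Qed.

Lemma lim_inS i (z : R i) : lim_in (f i z) = lim_in z.
Proof. exact: dlim_inS. Qed.

Lemma lim_in_inj i : injective (@lim_in i).
Proof.
move=> z w /dlim_inP[k [+ _]]; elim: k => [|k IHk].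
  by rewrite leqn0 => /eqP i0; move: z w; rewrite i0 => z w; rewrite !tfrom_id.
rewrite leq_eqVlt => /predU1P[ik|ik].
  by move: z w {IHk}; rewrite ik => z w; rewrite !tfrom_id.
by rewrite !tfromS // => /finj/(IHk ik).
Qed.

Lemma lim_in_graded i g (z : R i) : gcomp g z -> gcomp g (lim_in z).
Proof.
move=> gz; suff H k : (i <= k)%N -> gcomp g (tfrom f z k).
  by eexists; split; [reflexivity | exists i].
elim: k => [|k IHk].
  by rewrite leqn0 => /eqP i0; move: z gz; rewrite i0 => z gz; rewrite tfrom_id.
rewrite leq_eqVlt => /predU1P[ik|ik].
  by move: z gz {IHk}; rewrite ik => z gz; rewrite tfrom_id.
by rewrite tfromS //; apply/fgr/IHk.
Qed.

Definition at_stage i (x : A) := exists z : R i, x = lim_in z.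

Lemma at_stageS i x : at_stage i x -> at_stage i.+1 x.
Proof. by case=> z ->; exists (f i z); rewrite lim_inS. Qed.

Lemma at_stage_le i j x : (i <= j)%N -> at_stage i x -> at_stage j x.
Proof.
move=> ij xi; rewrite -(subnKC ij); elim: (j - i)%N => [|k IHk]; first by rewrite addn0.
by rewrite addnS; apply: at_stageS.
Qed.

Lemma at_stageM i x y : at_stage i x -> at_stage i y -> at_stage i (x * y).
Proof. by case=> z -> [w ->]; exists (z * w); rewrite lim_inM. Qed.

Lemma at_stage_ex x : exists i, at_stage i x.
Proof. by have [i [z ->]] := dlim_surj x; exists i, z. Qed.

Lemma at_stage_family (I : finType) (x : I -> A) :
  exists n, forall i, (n <= i)%N -> forall k, at_stage i (x k).
Proof.
have /choice[m mP] : forall k, exists i, at_stage i (x k) by move=> k; apply: at_stage_ex.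
exists (\max_k m k)%N => i mi k; apply: at_stage_le (mP k).
by apply: leq_trans mi; apply: leq_bigmax.
Qed.
End Limit.

(** * Matrix units in an infinite product *)

Section Stages.
Variables (F : fieldType) (G : finZmodType).
Variables (x0 : {ffun G -> nat}) (a : nat -> {ffun G -> nat}).
Local Notation T := (stage x0 a).
Local Notation A := (M_inf F x0 a).
Local Notation len i := (gt_len (stage x0 a i)).

Definition stage_in i : mx_galg F (T i) -> A :=
  @lim_in F G (fun i => mx_galg F (T i)) _
    (fun i => @tens1_graded F G (T i) (gtuple_of (a i))) i.

Definition in_stage i : A -> Prop :=
  @at_stage F G (fun i => mx_galg F (T i)) _
    (fun i => @tens1_graded F G (T i) (gtuple_of (a i))) i.

Lemma tens1_inj (s t : gtuple G) : injective (@tens1_hom F G s t).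
Proof.
move=> M N /matrixP E; apply/matrixP => i j.
have := E (mxtens_index (i, ord0)) (mxtens_index (j, ord0)).
by rewrite !mxE !mxtens_indexK /= !mulr1.
Qed.

Lemma stage_in_inj i : injective (@stage_in i).
Proof. by apply: lim_in_inj => j; apply: tens1_inj. Qed.

Definition munit i (p q : 'I_(len i).+1) : A :=
  stage_in (delta_mx p q : mx_galg F (T i)).

Lemma munitM i (p q r s : 'I_(len i).+1) :
  munit p q * munit r s = if q == r then munit p s else 0.
Proof.
rewrite -lim_inM; have -> : (delta_mx p q : mx_galg F (T i)) * delta_mx r s =
    if q == r then delta_mx p s else 0.
  by apply: etrans (mul_delta_mx_cond F q r p s) _; case: (q == r).
by case: (q == r); last exact: lim_in0.
Qed.

Lemma munit_graded i (p q : 'I_(len i).+1) : gcomp (T i p - T i q) (munit p q).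
Proof.
apply: lim_in_graded => k l; rewrite mxE.
by case: (k =P p) => [->|_]; case: (l =P q) => [->|_] //=; rewrite eqxx.
Qed.

Lemma munit_neq0 i (p q : 'I_(len i).+1) : munit p q != 0.
Proof.
apply/eqP; rewrite -[0](@lim_in0 _ _ (fun i => mx_galg F (T i)) _
  (fun i => @tens1_graded F G (T i) (gtuple_of (a i))) i).
by move/stage_in_inj/matrixP/(_ p q)/eqP; rewrite !mxE !eqxx /= oner_eq0.
Qed.

Lemma munit_sum1 i : \sum_(p < (len i).+1) munit p p = 1 :> A.
Proof.
rewrite -lim_in_sum -(@lim_in1 _ _ (fun i => mx_galg F (T i)) _ _ i); congr lim_in.
apply/matrixP => k l; rewrite summxE !mxE (bigD1 k) //= mxE eqxx big1 ?addr0.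
  by rewrite eq_sym.
by move=> p /negPf; rewrite mxE eq_sym => ->.
Qed.

Lemma munit_corner i (p q : 'I_(len i).+1) x : in_stage i x ->
  exists c : F, munit ord0 p * x * munit q ord0 = c *: munit (ord0 : 'I_(len i).+1) ord0.
Proof.
case=> z ->; exists ((z : 'M_((len i).+1)) p q); rewrite -!lim_inM -lim_inZ.
congr lim_in; apply/matrixP => k l; rewrite !mxE (bigD1 q) //= !mxE eqxx.
rewrite (bigD1 p) //= !mxE eqxx andbT [in LHS]big1 ?addr0; last first.
  by move=> r /negPf rp; rewrite !mxE rp andbF mul0r.
rewrite big1 ?addr0 => [|r /negPf rq]; last by rewrite !mxE rq mulr0.
case: (k == ord0); case: (l == ord0);
  by rewrite ?(mul1r, mulr1, mul0r, mulr0).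
Qed.

Definition corner i : A := munit (ord0 : 'I_(len i).+1) ord0.

Lemma corner_idem i : corner i * corner i = corner i.
Proof. by rewrite munitM eqxx. Qed.

Lemma corner_graded i : gcomp 0 (corner i).
Proof. by have := munit_graded (ord0 : 'I_(len i).+1) ord0; rewrite subrr. Qed.

Lemma corner_neq0 i : corner i != 0.
Proof. exact: munit_neq0. Qed.

Definition split_one i : splitting (1 : A) (corner i).
Proof.
refine (@Splitting _ _ A 1 (corner i) 'I_(len i).+1 (fun p => munit ord0 p)
  (fun p => munit p ord0) (fun p => T i ord0 - T i p) _ _ _ _ _).
- by rewrite -(munit_sum1 i); apply: eq_bigr => p _; rewrite munitM eqxx.
- move=> p q; exact: munitM.
- by move=> p; rewrite munitM eqxx.
- by move=> p; apply: munit_graded.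
- by move=> p; rewrite opprB; apply: munit_graded.
Defined.

(** The indices of stage i+1 that lie below the index 0 of stage i. *)
Definition succ_index i (q : 'I_(gt_len (gtuple_of (a i))).+1) : 'I_(len i.+1).+1 :=
  mxtens_index (ord0 : 'I_(len i).+1, q).

Lemma succ_index_deg i q : T i.+1 (@succ_index i q) = T i ord0 + gtuple_of (a i) q.
Proof.
exact: (congr1 (fun z => T i z.1 + gtuple_of (a i) z.2)
          (mxtens_indexK (ord0 : 'I_(len i).+1, q))).
Qed.

Lemma succ_index_inj i : injective (@succ_index i).
Proof.
move=> q r E; have [] // : (ord0 : 'I_(len i).+1, q) = (ord0, r).
exact: (can_inj (@mxtens_indexK (len i).+1 (gt_len (gtuple_of (a i))).+1) E).
Qed.

Lemma corner_split i : \sum_q munit (@succ_index i q) (succ_index q) = corner i.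
Proof.
rewrite -lim_in_sum /corner /munit /stage_in -[RHS]lim_inS; congr lim_in.
apply/matrixP => k l; rewrite summxE [RHS]mxE mxE.
pose N := ((len i).+1 * (gt_len (gtuple_of (a i))).+1)%N.
set k' := mxtens_unindex (k : 'I_N); set l' := mxtens_unindex (l : 'I_N).
have E q (r : 'I_N) :
    (r == succ_index q) = (mxtens_unindex r == (ord0, q)).
  by apply/eqP/eqP => [->|E]; rewrite /succ_index ?mxtens_indexK // -E mxtens_unindexK.
under eq_bigr => q _ do rewrite mxE !E -/k' -/l'.
move: k' l' => [k1 k2] [l1 l2] /=.
under eq_bigr => q _ do rewrite !xpair_eqE.
rewrite (bigD1 k2) //= [X in _ + X]big1 => [|q /negPf qk]; last first.
  by rewrite [k2 == q]eq_sym qk andbF.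
rewrite addr0 mxE eqxx andbT andbA -natrM mulnb.
by rewrite [l2 == _]eq_sym.
Qed.

Definition split_succ i : splitting (corner i) (corner i.+1).
Proof.
refine (@Splitting _ _ A _ _ _ (fun q => munit ord0 (@succ_index i q))
  (fun q => munit (@succ_index i q) ord0)
  (fun q => T i.+1 ord0 - T i.+1 (succ_index q)) _ _ _ _ _).
- by rewrite -corner_split; apply: eq_bigr => q _; rewrite munitM eqxx.
- by move=> q r; rewrite munitM (inj_eq (@succ_index_inj i)).
- by move=> q; rewrite munitM eqxx.
- by move=> q; apply: munit_graded.
- by move=> q; rewrite opprB; apply: munit_graded.
Defined.
End Stages.

(** * Group completions inside the group algebra *)

Section Completion.
Variables (G : finZmodType) (M : cmonoid G) (phi : M -> grpalg rat G) (u : M).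
Variables Kall Kpos : grpalg rat G -> Prop.
Hypothesis phi_inj : injective phi.
Hypothesis phiD : forall x y, phi (cm_add x y) = phi x + phi y.
Hypothesis phi_act : forall g x, phi (cm_act g x) = ga_act g (phi x).
Hypothesis KposP : forall z, Kpos z <-> exists x, z = phi x.
Hypothesis KallP : forall z, Kall z <-> exists x y, z = phi x - phi y.

(** phi being injective, M is cancellative and phi extends to an injection of
    the completion; its image consists of the differences of values of phi. *)
Lemma completion_iso :
  triple_iso
    (@Triple G (group_completion M) (fun=> True)
       (fun x => exists P : M, x = gc_in P) (gc_in u))
    (@Triple G (ga_zgmod rat G) Kall Kpos (phi u)).
Proof.
pose f (x : gc_sort M) : grpalg rat G := phi (rep_of x).1 - phi (rep_of x).2.
have fE p : f (gc_cls p) = phi p.1 - phi p.2.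
  have [r /(congr1 phi)] := gc_repP p; rewrite !phiD => /addIr E.
  by apply/eqP; rewrite /f subr_eq addrAC eq_sym subr_eq E.
have f_inj : injective f.
  move=> x y; have [[p ->] [q ->]] := (gc_clsE x, gc_clsE y); rewrite !fE => E.
  apply/gc_clsP; exists (cm_zero M); congr cm_add; apply: phi_inj; rewrite !phiD.
  by apply/eqP; rewrite -subr_eq addrAC E subrK.
have phi0 : phi (cm_zero M) = 0.
  by apply: (addrI (phi (cm_zero M))); rewrite -phiD cm_add0 addr0.
have f_in x : f (gc_in x) = phi x by rewrite fE phi0 subr0.
have fD x y : f (gc_add x y) = f x + f y.
  have [[p ->] [q ->]] := (gc_clsE x, gc_clsE y).
  by rewrite gc_addE !fE /= !phiD opprD addrACA.
have f_act g x : f (gc_act g x) = ga_act g (f x).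
  have [p ->] := gc_clsE x.
  by rewrite gc_actE !fE /= !phi_act /ga_act mulrBr.
have f_onto z : Kall z <-> exists x, z = f x.
  rewrite KallP; split=> [[x [y ->]]|[x ->]]; first by exists (gc_cls (x, y)); rewrite fE.
  by have [p ->] := gc_clsE x; exists p.1, p.2; rewrite fE.
have /choice[h hP] z : exists x, (exists y, z = f y) -> z = f x.
  have [[y ->]|nz] := pselect (exists y, z = f y); first by exists y.
  by exists (gc_zero M) => /nz.
have fK x : h (f x) = x by apply: f_inj; rewrite -hP //; exists x.
exists f, h; split=> //=.
- split=> //= [x _|x [y ->]]; first by apply/f_onto; exists x.
  by apply/KposP; exists y.
- split=> //= [x y /f_onto[p ->] /f_onto[q ->]|g x /f_onto[p ->]|x /KposP[y ->]|].
  + by rewrite -[p in RHS]fK -[q in RHS]fK -fD !fK.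
  + by rewrite -f_act !fK.
  + by exists y; rewrite -f_in fK.
  + by rewrite -f_in fK.
- by move=> y /f_onto[x ->]; rewrite fK.
Qed.
End Completion.

(** * Multiplicities in an infinite product *)

Section Multiplicities.
Variables (F : fieldType) (G : finZmodType).
Variables (x0 : {ffun G -> nat}) (a : nat -> {ffun G -> nat}).
Hypothesis a_neq0 : forall i, a i <> [ffun=> 0%N].
Local Notation T := (stage x0 a).
Local Notation A := (M_inf F x0 a).
Local Notation QG := (grpalg rat G).
Local Notation abar i := (ga_bar (ga_nat (a i)) : QG).
Implicit Types (P Q : gmod A).

Lemma gtuple_of_sum (x : {ffun G -> nat}) : x <> [ffun=> 0%N] ->
  \sum_q ga_elt rat (- gtuple_of x q) = ga_bar (ga_nat x).
Proof.
move=> x_neq0; have sz : (0 < size (gseq x))%N.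
  rewrite lt0n size_eq0; apply/eqP => s0; apply: x_neq0; apply/ffunP => g.
  by rewrite ffunE -count_gseq s0.
have -> : \sum_q ga_elt rat (- gtuple_of x q) = \sum_(g <- gseq x) ga_elt rat (- g).
  by rewrite [RHS](big_nth 0) -[in RHS](prednK sz) big_mkord.
apply/ffunP => g; rewrite sum_ffunE !ffunE -count_gseq -sum1_count natr_sum [RHS]big_mkcond.
by apply: eq_bigr => h _; rewrite ffunE [g == _]eq_sym eqr_oppLR -mulrb.
Qed.

(** The degrees are counted from that of the generator c_i of V_i, which is
    t_i(0): multiplicities refer to the shifts of V_i and not of A c_i. *)
Definition frame_mult i P (b : dual_basis P) : QG :=
  \sum_k ga_elt rat (db_d (d := b) k - T i ord0).

Lemma frame_multE i P (b : dual_basis P) g : frame_mult i b g = (db_count b (g + T i ord0))%:R.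
Proof.
rewrite sum_ffunE /db_count -sum1_card natr_sum [RHS]big_mkcond.
by apply: eq_bigr => k _; rewrite ffunE !inE eq_sym subr_eq; case: eqP.
Qed.

(** The generator w_k of degree d_k is replaced by the E_0q w_k, of degrees
    d_k + t_(i+1)(0) - t_(i+1)(q), where t_(i+1)(q) = t_i(0) + a_(i+1)(q). *)
Lemma frame_mult_refine i P (b : dual_basis P) (fb : frame (corner F x0 a i) b) :
  frame_mult i.+1 (db_refine (split_succ F x0 a i) fb.2) = frame_mult i b * abar i.
Proof.
rewrite -gtuple_of_sum // /frame_mult big_distrlr /= pair_bigA /=.
apply: eq_bigr => -[k q] _ /=; rewrite -ga_eltM; congr ga_elt.
rewrite [X in _ - X + _](@succ_index_deg _ x0 a i q).
by rewrite addrAC [X in X - _ + _]addrC addrK addrC opprD addrA.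
Qed.
End Multiplicities.

Lemma frame_gen (F : fieldType) (G : finZmodType) (A : galg F G) (P : gmod A)
  (b : dual_basis P) e (k : db_I b) : frame e b -> e *: db_w k = db_w k.
Proof.
case=> fb _; rewrite -[RHS](db_sum b) (bigD1 k) //= fb eqxx big1 ?addr0 // => l lk.
by rewrite fb eq_sym (negPf lk) scale0r.
Qed.

Section Frames.
Variables (F : fieldType) (G : finZmodType).
Variables (x0 : {ffun G -> nat}) (a : nat -> {ffun G -> nat}).
Hypothesis a_neq0 : forall i, a i <> [ffun=> 0%N].
Local Notation T := (stage x0 a).
Local Notation A := (M_inf F x0 a).
Local Notation QG := (grpalg rat G).
Local Notation abar i := (ga_bar (ga_nat (a i)) : QG).
Local Notation corner i := (corner F x0 a i).
Implicit Types (P Q : gmod A).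

(** Refining a dual basis along 1 = sum of the E_p0 E_0p makes its Gram matrix
    scalar, once the entries of that matrix come from the stage considered. *)
Lemma frame_ex P : fin_gen P -> gprojective P ->
  exists i (b : dual_basis P), frame (corner i) b.
Proof.
move=> fP pP; have [b] := dual_basis_ex fP pP.
have fe (k : db_I b) x : db_f k x * 1 = db_f k x by rewrite mulr1.
have [n /(_ n (leqnn n)) Mn] :=
  at_stage_family (fun kl : db_I b * db_I b => db_f kl.2 (db_w kl.1) : A).
pose b' := db_refine (split_one F x0 a n) fe.
have /choice[c cP] : forall kl : db_I b' * db_I b', exists c : F,
    db_f kl.2 (db_w kl.1) = c *: corner n.
  move=> [[k p] [l q]] /=; rewrite db_fZ.
  exact: munit_corner (Mn (k, l)).
exists n; apply: (frame_of_gram (corner_idem F x0 a n) (corner_graded F x0 a n)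
  (corner_neq0 F x0 a n) (b := b') (c := fun k l => c (k, l))).
  exact: refine_fe.
by move=> k l; apply: cP (k, l).
Qed.

(** One stage later the multiplicities are equal, and frames with equal
    multiplicities are matched by a bijection that preserves degrees. *)
Lemma frame_mult_iso i P Q (b : dual_basis P) (c : dual_basis Q) :
  frame (corner i) b -> frame (corner i) c ->
  frame_mult i b * abar i = frame_mult i c * abar i -> gmod_iso P Q.
Proof.
move=> fb fc; rewrite -!frame_mult_refine // => E.
have e'e' := corner_idem F x0 a i.+1; pose s := split_succ F x0 a i.
apply: (frame_iso (frame_refine s fb e'e') (frame_refine s fc e'e')) => g.
move/ffunP/(_ (g - T i.+1 ord0)): E; rewrite !frame_multE subrK => /eqP.
by rewrite eqr_nat => /eqP.
Qed.

Lemma frame_realize i (s : seq G) : exists (P : fgp A) (b : dual_basis P),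
  frame (corner i) b /\ frame_mult i b = \sum_(g <- s) ga_elt rat g.
Proof.
elim: s => [|g s [P [b [fb bs]]]].
  pose w (k : void) : gmod0 A := 0; pose f (k : void) (x : gmod0 A) : A := 0.
  have lin k c x y : f k (c *: x + y) = c * f k x + f k y by case: k.
  have wdeg (k : void) : mcomp (0 : G) (w k) by case: k.
  have fdeg (k : void) (h : G) (x : gmod0 A) : mcomp h x -> gcomp (h - 0) (f k x).
    by case: k.
  have sum (x : gmod0 A) : \sum_k f k x *: w k = x by rewrite [LHS]thinmx0 [RHS]thinmx0.
  exists (fgp0 A), (DualBasis lin wdeg fdeg sum); split; first by split=> [[]|[]].
  by rewrite big_nil; apply: big1 => -[].
have [c fc cE] := left_ideal_frame (corner_idem F x0 a i) (corner_graded F x0 a i).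
have [c' fc' c'E] := frame_shift (g + T i ord0) fc.
have [d fd dE] := frame_sum fc' fb.
pose L := left_ideal_fgp (corner_idem F x0 a i) (corner_graded F x0 a i).
exists (fgp_sum (fgp_shift (g + T i ord0) L) P), d; split=> //.
rewrite big_cons -bs; apply/ffunP => h; rewrite [RHS]ffunE !frame_multE dE c'E cE natrD.
by rewrite opprD addrACA subrr addr0 subr_eq0 ffunE.
Qed.

Section Values.
(* u i stands for the inverse of the product of the conjugates of the first i
   factors. *)
Variable u : nat -> QG.
Hypothesis u_abar : forall i, u i.+1 * abar i = u i.

Definition frame_val i P (b : dual_basis P) : QG := u i * frame_mult i b.

Lemma frame_val_refine i P (b : dual_basis P) (fb : frame (corner i) b) :
  frame_val i.+1 (db_refine (split_succ F x0 a i) fb.2) = frame_val i b.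
Proof. by rewrite /frame_val frame_mult_refine // mulrCA u_abar mulrC. Qed.

Lemma frame_up i j P (b : dual_basis P) : frame (corner i) b -> (i <= j)%N ->
  exists2 c : dual_basis P, frame (corner j) c & frame_val j c = frame_val i b.
Proof.
move=> fb ij; rewrite -(subnKC ij); elim: (j - i)%N => [|k [c fc cb]].
  by rewrite addn0; exists b.
rewrite addnS -cb -(frame_val_refine fc); exists (db_refine (split_succ F x0 a _) fc.2) => //.
exact/frame_refine/corner_idem.
Qed.

(** The transition matrices between two frames have their entries in some later
    stage i + n. Refining both frames lowers n; when n = 0 the entries, which lie
    in the corner algebra of a matrix unit, are scalars. *)
Lemma frame_val_stage n i P (b c : dual_basis P) :
  frame (corner i) b -> frame (corner i) c ->
  (forall (k : db_I b) (l : db_I c), in_stage (i + n) (db_f l (db_w k) : A)) ->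
  (forall (k : db_I b) (l : db_I c), in_stage (i + n) (db_f k (db_w l) : A)) ->
  frame_val i b = frame_val i c.
Proof.
elim: n => [|n IHn] in i b c * => fb fc bc cb; last first.
  rewrite -(frame_val_refine fb) -(frame_val_refine fc).
  have e'e' := corner_idem F x0 a i.+1.
  have up p q : in_stage (i.+1 + n) (munit F (x0 := x0) (a := a) (i := i.+1) p q).
    by apply: (@at_stage_le _ _ _ _ _ i.+1); [apply: leq_addr | eexists].
  apply: IHn; try exact: frame_refine.
    move=> [k p] [l q] /=; rewrite db_fZ; do 2?apply: at_stageM; try exact: up.
    by rewrite addSnnS; apply: bc.
  move=> [k p] [l q] /=; rewrite db_fZ; do 2?apply: at_stageM; try exact: up.
  by rewrite addSnnS; apply: cb.
have scal (b1 b2 : dual_basis P) : frame (corner i) b1 -> frame (corner i) b2 ->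
    (forall (k : db_I b1) (l : db_I b2), in_stage i (db_f l (db_w k) : A)) ->
    exists X : db_I b1 -> db_I b2 -> F,
      forall k l, db_f l (db_w k) = X k l *: corner i.
  move=> f1 f2 st; have /choice[X XP] : forall kl : db_I b1 * db_I b2,
      exists c : F, db_f kl.2 (db_w kl.1) = c *: corner i.
    move=> [k l] /=; rewrite -[db_f l _](f2.2) -(frame_gen k f1) db_fZ.
    exact: munit_corner (st k l).
  by exists (fun k l => X (k, l)) => k l; apply: XP (k, l).
rewrite addn0 in bc cb.
have [X XP] := scal _ _ fb fc bc; have [Y YP] := scal _ _ fc fb (fun l k => cb k l).
rewrite /frame_val; congr (_ * _); apply/ffunP => g; rewrite !frame_multE; congr (_%:R).
exact: (frame_count_eq (corner_idem F x0 a i) (corner_graded F x0 a i)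
  (corner_neq0 F x0 a i) fb fc XP (fun k l => YP l k) _).
Qed.

(** Both frames are first brought to a common stage. *)
Lemma frame_val_uniq i j P (b c : dual_basis P) :
  frame (corner i) b -> frame (corner j) c -> frame_val i b = frame_val j c.
Proof.
move=> fb fc.
have [b' fb' <-] := frame_up fb (leq_maxl i j).
have [c' fc' <-] := frame_up fc (leq_maxr i j).
have [n bc] := at_stage_family
  (fun kl : db_I b' * db_I c' => db_f kl.2 (db_w kl.1) : A).
have [m cb] := at_stage_family
  (fun kl : db_I b' * db_I c' => db_f kl.1 (db_w kl.2) : A).
apply: (frame_val_stage (n := maxn n m)) => // k l.
  by apply: (bc _ _ (k, l)); rewrite (leq_trans (leq_maxl n m)) ?leq_addl.
by apply: (cb _ _ (k, l)); rewrite (leq_trans (leq_maxr n m)) ?leq_addl.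
Qed.
End Values.
End Frames.

(** * Localization at the conjugates of the factors *)

Section StandardForm.
Variables (G : finZmodType) (S : {set {set Iirr [set: G]}}).
Variables (x0 : {ffun G -> nat}) (a : nat -> {ffun G -> nat}).
Hypothesis stdA : standard_form S x0 a.
Local Notation QG := (grpalg rat G).
Local Notation abar i := (ga_bar (ga_nat (a i)) : QG).
Local Notation e := (pi_ S 1 : QG).

Lemma standard_orbits : S \subset gal_orbits G.
Proof. by rewrite -(stdA.1 0%N); apply/subsetP => o; rewrite inE => /andP[]. Qed.

Lemma char_eval_factor i (j : Iirr [set: G]) :
  (char_eval j (abar i) != 0) = (gal_orbit j \in S).
Proof.
rewrite char_eval_bar fmorph_eq0 -(stdA.1 i).
by rewrite (in_supp _ (gal_orbit_in j) (gal_orbit_refl j)).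
Qed.

Lemma factor_pi1 i : abar i * e = abar i.
Proof.
by apply: mulr_pi1 => [|j]; [apply: standard_orbits | rewrite char_eval_factor].
Qed.

Lemma localizer_ex i : exists v, inverse_in S (pi_ S (b_ a i)) v.
Proof.
apply: inverse_in_ex => [|j jS]; first exact: standard_orbits.
rewrite rmorph_prod /=; apply/prodf_neq0 => k _.
by rewrite char_eval_factor.
Qed.

Lemma inverse_inE z v : inverse_in S (pi_ S z) v -> v * e = v /\ v * z = e.
Proof.
case=> -[w ->] E; have So := standard_orbits.
have we : pi_ S w * e = pi_ S w by rewrite pi_E mulrAC pi1_idem.
by split=> //; rewrite -E (pi_E S z) mulrA we.
Qed.

Lemma localizer_uniq z v v' :
  inverse_in S (pi_ S z) v -> inverse_in S (pi_ S z) v' -> v = v'.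
Proof.
by move=> /inverse_inE[ve vz] /inverse_inE[ve' vz']; rewrite -ve -vz' mulrCA vz.
Qed.

Lemma localizerS i v v' : inverse_in S (pi_ S (b_ a i)) v ->
  inverse_in S (pi_ S (b_ a i.+1)) v' -> v' * abar i = v.
Proof.
move=> /inverse_inE[ve vz] /inverse_inE[ve' vz'].
rewrite -[RHS]ve -vz' /b_ big_ord_recr /= -/(b_ a i).
by rewrite [v * _]mulrCA [v * _]mulrA vz [e * _]mulrC factor_pi1.
Qed.

(** Multiplying by the product of the first i conjugates shows that y and y'
    agree at the characters in S; at the others the factor vanishes. *)
Lemma localizer_ker i v y y' : inverse_in S (pi_ S (b_ a i)) v ->
  v * y = v * y' -> y * abar i = y' * abar i.
Proof.
move=> /inverse_inE[_ vz] E; rewrite -factor_pi1 -vz.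
by rewrite !(mulrCA _ (abar i)); congr (_ * _); rewrite ![_ * (v * _)]mulrA ![_ * v]mulrC E.
Qed.
End StandardForm.

Lemma ga_nat_gseq (G : finZmodType) (y : {ffun G -> nat}) :
  \sum_(g <- gseq y) ga_elt rat g = ga_nat y.
Proof.
apply/ffunP => g; rewrite sum_ffunE !ffunE -count_gseq -sum1_count natr_sum [RHS]big_mkcond.
by apply: eq_bigr => h _; rewrite ffunE eq_sym -mulrb.
Qed.

Lemma ga_intE (G : finZmodType) (y : {ffun G -> int}) :
  exists p q : {ffun G -> nat}, ga_int y = ga_nat p - ga_nat q.
Proof.
exists [ffun g => if y g is Posz n then n else 0%N].
exists [ffun g => if y g is Negz n then n.+1 else 0%N].
apply/ffunP => g; rewrite !ffunE; case: (y g) => n; first by rewrite subr0.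
by rewrite sub0r NegzE mulrNz.
Qed.

(** As A is the sum of the A E_pp, the generators are the E_0p; the degree of
    E_0p, counted from t_0(0), is the inverse of that of the index p. *)
Lemma regular_frame (F : fieldType) (G : finZmodType) (x0 : {ffun G -> nat})
    (a : nat -> {ffun G -> nat}) : x0 <> [ffun=> 0%N] ->
  exists2 b : dual_basis (greg (M_inf F x0 a)), frame (corner F x0 a 0) b &
    frame_mult 0 b = ga_bar (ga_nat x0).
Proof.
move=> x0_neq0; set A := M_inf F x0 a.
have lin (k : unit) (c x y : A) : c * x + y = c * x + y by [].
have wdeg (k : unit) : mcomp 0 (1 : greg A) by apply: gcomp1.
have fdeg (k : unit) h (x : greg A) : mcomp h x -> gcomp (h - 0) (x : A).
  by rewrite subr0.
have sum (x : greg A) : \sum_(k : unit) (x : A) *: (1 : greg A) = x.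
  by rewrite big_const card_unit /= addr0; apply: mulr1.
pose b := @DualBasis _ _ _ (greg A) unit (fun=> 1 : greg A) (fun _ x => (x : A))
  (fun=> 0) lin wdeg fdeg sum.
have f1 : frame (1 : A) b by split=> [[] []|k x] //=; apply: mulr1.
exists (db_refine (split_one F x0 a 0) f1.2).
  exact/frame_refine/corner_idem.
rewrite -gtuple_of_sum // /frame_mult (reindex (pair tt)) /=; last first.
  by exists snd => [q|[[] q]].
apply: eq_bigr => q _; congr ga_elt.
by rewrite addr0 addrAC subrr sub0r.
Qed.

Theorem proposition14 (G : finZmodType) (F : fieldType)
    (x0 : {ffun G -> nat}) (a : nat -> {ffun G -> nat})
    (S : {set {set Iirr [set: G]}})
    (x0_neq0 : x0 <> [ffun=> 0%N]) (a_neq0 : forall i, a i <> [ffun=> 0%N])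
    (stdA : standard_form S x0 a) :
  triple_iso (K0gr (M_inf F x0 a)) (K_triple S x0 a).
Proof.
set A := M_inf F x0 a.
have /choice[u uP] : forall i, exists v, inverse_in S (pi_ S (b_ a i)) v.
  by move=> i; apply: (localizer_ex stdA).
have uS i : u i.+1 * ga_bar (ga_nat (a i)) = u i.
  exact: (localizerS stdA (uP i) (uP i.+1)).
have u_pi i z : u i * pi_ S z = u i * z.
  by rewrite pi_E mulrA; have [-> _] := inverse_inE stdA (uP i).
(* The localized multiplicities, at any stage that carries a frame. *)
have /choice[val valP] : forall P : fgp A, exists v, exists i (b : dual_basis P),
    frame (corner F x0 a i) b /\ v = frame_val u i b.
  move=> P; have [i [b fb]] := frame_ex (fgp_fg P) (@fgp_proj _ _ _ P).
  by exists (frame_val u i b), i, b.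
have valE i (P : fgp A) (b : dual_basis P) :
    frame (corner F x0 a i) b -> val P = frame_val u i b.
  have [j [c [fc ->]]] := valP P; move=> fb.
  exact: (frame_val_uniq a_neq0 uS fc fb).
pose phi (x : K0gr_monoid A) := val (rep_of x).
have phiE (P : fgp A) : phi (icls P) = val P.
  have [i [b [fb ->]]] := valP P.
  have [c fc bc] := frame_transport fb (gmod_iso_sym (icls_rep P)).
  rewrite /phi (valE _ _ _ fc) /frame_val; congr (_ * _).
  by apply/ffunP => g; rewrite !frame_multE bc.
(* All late stages carry a frame of P, so two modules have frames at a common
   stage; it can be taken positive, as in the definitions of K and K^+. *)
have frames (P : fgp A) : exists n, forall i, (n <= i)%N ->
    exists2 b : dual_basis P, frame (corner F x0 a i) b & val P = frame_val u i b.
  have [n [b [fb ->]]] := valP P; exists n => i ni.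
  by have [c fc <-] := frame_up a_neq0 uS fb ni; exists c.
have common (P Q : fgp A) : exists2 i, (0 < i)%N &
    (exists2 b : dual_basis P, frame (corner F x0 a i) b & val P = frame_val u i b) /\
    (exists2 c : dual_basis Q, frame (corner F x0 a i) c & val Q = frame_val u i c).
  have [[n nP] [m mP]] := (frames P, frames Q); exists (maxn n m).+1 => //.
  by split; [apply: nP | apply: mP]; apply: leqW; rewrite ?leq_maxl ?leq_maxr.
have mult_nat i (P : fgp A) (b : dual_basis P) :
    exists y : {ffun G -> nat}, frame_mult i b = ga_nat y.
  exists [ffun g => db_count b (g + stage x0 a i ord0)].
  by apply/ffunP => g; rewrite frame_multE !ffunE.
have realize i (y : {ffun G -> nat}) : exists P : fgp A, val P = u i * ga_nat y.
  have [P [b [fb bE]]] := frame_realize F x0 a i (gseq y).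
  by exists P; rewrite (valE _ _ _ fb) /frame_val bE ga_nat_gseq.
have u0 z : u 0%N * z = pi_ S z.
  have [ue] := inverse_inE stdA (uP 0%N).
  by rewrite /b_ big_ord0 mulr1 => ->; rewrite -pi_E.
have unitE : val (fgp_reg A) = pi_ S (ga_bar (ga_nat x0)).
  have [b fb bE] := regular_frame F a x0_neq0.
  by rewrite (valE 0%N (fgp_reg A) b fb) /frame_val bE u0.
rewrite /K0gr /K_triple -unitE -phiE.
apply: completion_iso.
- move=> x y; have [[P ->] [Q ->]] := (@iclsE _ _ A x, @iclsE _ _ A y); rewrite !phiE => E.
  have [i _ [[b fb Pb] [c fc Qc]]] := common P Q.
  apply/iclsP/(frame_mult_iso a_neq0 fb fc)/(localizer_ker stdA (uP i)).
  by rewrite -[LHS]Pb E Qc.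
- move=> x y; have [[P ->] [Q ->]] := (@iclsE _ _ A x, @iclsE _ _ A y).
  rewrite [cm_add _ _]icls_addE !phiE.
  have [i _ [[b fb ->] [c fc ->]]] := common P Q.
  have [d fd dE] := frame_sum fb fc.
  rewrite (valE i (fgp_sum P Q) d fd) /frame_val -mulrDr; congr (_ * _).
  by apply/ffunP => g; rewrite ffunE !frame_multE dE natrD.
- move=> g x; have [P ->] := @iclsE _ _ A x; rewrite [cm_act _ _]icls_actE !phiE.
  have [i _ [[b fb ->] _]] := common P P.
  have [c fc cE] := frame_shift g fb.
  rewrite (valE i (fgp_shift g P) c fc) /frame_val /ga_act mulrCA; congr (_ * _).
  apply/ffunP => h; rewrite frame_multE cE [RHS]ffunE (bigD1 g) //= ffunE eqxx mul1r.
  rewrite big1 ?addr0 => [|k /negPf kg]; last by rewrite ffunE kg mul0r.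
  by rewrite frame_multE addrAC.
- move=> z; split=> [[i [v [y [i0 vP ->]]]]|[x ->]].
    rewrite (localizer_uniq stdA vP (uP i)) u_pi.
    by have [P <-] := realize i y; exists (icls P); rewrite phiE.
  have [P ->] := @iclsE _ _ A x; rewrite phiE.
  have [i i0 [[b fb ->] _]] := common P P; have [y yE] := mult_nat i P b.
  by exists i, (u i), y; split=> //; rewrite u_pi -yE.
- move=> z; split=> [[i [v [y [i0 vP ->]]]]|[x [x' ->]]].
    rewrite (localizer_uniq stdA vP (uP i)) u_pi; have [p [q ->]] := ga_intE y.
    have [[P Pp] [Q Qq]] := (realize i p, realize i q).
    by exists (icls P), (icls Q); rewrite !phiE Pp Qq mulrBr.
  have [[P ->] [Q ->]] := (@iclsE _ _ A x, @iclsE _ _ A x'); rewrite !phiE.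
  have [i i0 [[b fb ->] [c fc ->]]] := common P Q.
  have [[p pE] [q qE]] := (mult_nat i P b, mult_nat i Q c).
  exists i, (u i), [ffun g => (p g)%:Z - (q g)%:Z]; split=> //.
  rewrite u_pi /frame_val pE qE -mulrBr; congr (_ * _).
  by apply/ffunP => g; rewrite !ffunE rmorphB.
Qed.
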